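(* Let $n\ge1$, $r>0$, and assume that $B \subset [-r,r]^n$ is a Borel set with $\chi_B \in \mathrm{BV}_c^\alpha(\mathbb R^n)$ for some $\alpha \in [0,1[$. Then for all $d \in \,]n-1+\alpha,n]$, \[\mathscr L^n(B) \leq C(n,d,\alpha,r)\, \mathbf V^\alpha(\chi_B)^{\frac{n}{d}},\] where $C(n,d,\alpha,r)$ is a finite constant depending only on the indicated quantities.
   Context: $\mathscr L^n$ is Lebesgue measure and $L^1_c(\mathbb R^n)$ denotes integrable functions with (essentially) compact support. For $\alpha\in[0,1]$, $\mathrm{Lip}^\alpha(g)=\sup_{x\ne y}|g(x)-g(y)|/|x-y|^\alpha$ and $\mathrm{Lip}=\mathrm{Lip}^1$. For $u\in L^1_c(\mathbb R^n)$, $\mathbf V^\alpha(u)$ is the smallest $C\in[0,\infty]$ such that $\bigl|\int_{\mathbb R^n} u\det D(f,g^1,\dots,g^{n-1})\,dx\bigr|\le C\,\mathrm{Lip}^\alpha(f)\,\mathrm{Lip}(g^1)\cdots\mathrm{Lip}(g^{n-1})$ for all $f,g^1,\dots,g^{n-1}\in\mathrm{Lip}(\mathbb R^n)$, and $\mathrm{BV}^\alpha_c(\mathbb R^n)=\{u\in L^1_c(\mathbb R^n):\mathbf V^\alpha(u)<\infty\}$. *)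

(* Defs.v *)
From HB Require Import structures.
From mathcomp Require Import all_boot all_order all_algebra.
From mathcomp Require Import all_classical all_reals all_analysis.
From mathcomp Require Import measurable_realfun.
Import Order.TTheory GRing.Theory Num.Theory.
Import numFieldNormedType.Exports.

Set Implicit Arguments.
Unset Strict Implicit.
Unset Printing Implicit Defensive.

Local Open Scope classical_set_scope.
Local Open Scope ring_scope.

(* Borel sigma-algebra of the (sup-norm, equivalently Euclidean) topology. *)
Section borel_matrix.
Variables (R : realType) (m n : nat).

HB.instance Definition _ := @isMeasurable.Build
  (sigma_display (@open 'M[R]_(m, n))) 'M[R]_(m, n) <<s @open 'M[R]_(m, n) >>
  (@sigma_algebra0 _ setT _) (@sigma_algebraC _ _)
  (@sigma_algebra_bigcup _ setT _).

End borel_matrix.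

Section lebesgue_cons.
Local Open Scope ereal_scope.
Variable R : realType.
Local Notation T := (measurableTypeR R).
Variables (n : nat) (mu : {sigma_finite_measure set (n.-tuple T) -> \bar R}).

Definition tuple_cons (x : T * n.-tuple T) : n.+1.-tuple T :=
  [tuple of x.1 :: x.2].

Lemma measurable_tuple_cons : measurable_fun setT tuple_cons.
Proof. by apply: measurable_cons; [exact: measurable_fst|exact: measurable_snd]. Qed.

HB.instance Definition _ :=
  isMeasurableFun.Build _ _ _ _ tuple_cons measurable_tuple_cons.

(* Product of the Lebesgue measure on R and mu, as a measure on R^(n+1). *)
Definition lebesgue_cons : set (n.+1.-tuple T) -> \bar R :=
  pushforward ((@lebesgue_measure R) \x mu) tuple_cons.

Let lebesgue_cons0 : lebesgue_cons set0 = 0.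
Proof. by rewrite /lebesgue_cons /pushforward preimage_set0 measure0. Qed.

Let lebesgue_cons_ge0 A : 0 <= lebesgue_cons A.
Proof. exact: measure_ge0. Qed.

Let lebesgue_cons_sigma_additive : semi_sigma_additive lebesgue_cons.
Proof. exact: measure_semi_sigma_additive. Qed.

HB.instance Definition _ := isMeasure.Build _ _ _ lebesgue_cons
  lebesgue_cons0 lebesgue_cons_ge0 lebesgue_cons_sigma_additive.

Let lebesgue_cons_sigma_finite : sigma_finite setT lebesgue_cons.
Proof.
have /sigma_finiteP[F [FT ndF Foo]] := sigma_finiteT (@lebesgue_measure R).
have /sigma_finiteP[G [GT ndG Goo]] := sigma_finiteT mu.
pose uncons (t : n.+1.-tuple T) := (thead t, [tuple of behead t]).
have consK : cancel tuple_cons uncons.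
  by case=> x t; congr pair; exact/val_inj.
have muncons : measurable_fun setT uncons.
  apply/measurable_fun_pairP; split; first exact: measurable_tnth.
  exact: measurable_behead.
exists (fun k => uncons @^-1` (F k `*` G k)).
  apply/seteqP; split=> // t _.
  have [i _ Fi] : (\bigcup_k F k) (uncons t).1 by rewrite -FT.
  have [j _ Gj] : (\bigcup_k G k) (uncons t).2 by rewrite -GT.
  exists (maxn i j) => //; split.
  - by move: Fi; exact/subsetPset/ndF/leq_maxl.
  - by move: Gj; exact/subsetPset/ndG/leq_maxr.
move=> k; have [mFk Fkoo] := Foo k; have [mGk Gkoo] := Goo k; split.
  by rewrite -[X in measurable X]setTI; apply: muncons => //; exact: measurableX.
rewrite /lebesgue_cons /pushforward -comp_preimage.
rewrite (_ : uncons \o tuple_cons = id); last exact/funext.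
by rewrite preimage_id product_measure1E// lte_mul_pinfty// ge0_fin_numE.
Qed.

HB.instance Definition _ := Measure_isSigmaFinite.Build _ _ _ lebesgue_cons
  lebesgue_cons_sigma_finite.

End lebesgue_cons.

Fixpoint lebesgue_tuple (R : realType) (n : nat) :
    {sigma_finite_measure set (n.-tuple (measurableTypeR R)) -> \bar R} :=
  if n is m.+1 then lebesgue_cons (lebesgue_tuple R m) else \d_[tuple].

Section lebesgue_rV.
Variables (R : realType) (n : nat).
Local Notation T := (measurableTypeR R).

Definition row_of_tuple (t : n.-tuple T) : 'rV[R]_n := \row_i tnth t i.

Lemma measurable_row_of_tuple : measurable_fun setT row_of_tuple.
Proof.
apply: (@measurability _ _ _ _ _ _ (@open 'rV[R]_n)) => //.
move=> _ [U oU <-]; rewrite setTI.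
pose box (c : 'rV[rat]_n * nat) : set 'rV[R]_n :=
  [set x | forall i, `|ratr (c.1 ord0 i) - x ord0 i| < c.2.+1%:R^-1].
have -> : U = \bigcup_(c in [set c | box c `<=` U]) box c.
  apply/seteqP; split=> [x Ux|x [c cU]]; last exact: cU.
  have /nbhs_ballP[e /= e0 xeU] : nbhs x U by exact: open_nbhs_nbhs.
  have [k ke] : exists k : nat, k.+1%:R^-1 < e / 2 :> R.
    exists (Num.truncn (e / 2)^-1).
    by rewrite invf_plt ?posrE ?divr_gt0// truncnS_gt.
  have [q xq] : exists q : 'rV[rat]_n,
      forall i, `|ratr (q ord0 i) - x ord0 i| < k.+1%:R^-1.
    have /choice[q qP] (i : 'I_n) :
        exists q : rat, `|ratr q - x ord0 i| < k.+1%:R^-1.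
      have /rat_in_itvoo[q] : x ord0 i - k.+1%:R^-1 < x ord0 i + k.+1%:R^-1.
        by rewrite ltrD2l gtrN.
      by rewrite in_itv/= -ltr_distl => ?; exists q.
    by exists (\row_i q i) => i; rewrite mxE.
  exists (q, k) => //= y qy; apply: xeU; split=> // i j.
  rewrite (ord1 i) /ball/=.
  rewrite (le_lt_trans (ler_distD (ratr (q ord0 j)) _ _))//.
  rewrite [e]splitr ltrD//; last exact: (lt_trans (qy j)).
  by rewrite distrC; exact: (lt_trans (xq j)).
rewrite preimage_bigcup bigcup_mkcond.
apply: countable_bigcupT_measurable => // c; case: ifPn => // _.
have -> : row_of_tuple @^-1` box c =
    \big[setI/setT]_(i < n) ((fun t => tnth t i) @^-1` ball (ratr (c.1 ord0 i) : R) c.2.+1%:R^-1).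
  rewrite -bigcap_seq; apply/seteqP; split=> [t ct i _|t ct i]/=.
    by have := ct i; rewrite mxE.
  by rewrite mxE; apply: ct => /=; rewrite mem_index_enum.
apply: bigsetI_measurable => i _; rewrite -[X in measurable X]setTI.
apply: measurable_tnth => //; exact: measurable_ball.
Qed.

HB.instance Definition _ :=
  isMeasurableFun.Build _ _ _ _ row_of_tuple measurable_row_of_tuple.

Definition lebesgue_rV : set 'rV[R]_n -> \bar R :=
  pushforward (lebesgue_tuple R n) row_of_tuple.

Let lebesgue_rV0 : lebesgue_rV set0 = 0%E.
Proof. by rewrite /lebesgue_rV /pushforward preimage_set0 measure0. Qed.

Let lebesgue_rV_ge0 A : (0 <= lebesgue_rV A)%E.
Proof. exact: measure_ge0. Qed.

Let lebesgue_rV_sigma_additive : semi_sigma_additive lebesgue_rV.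
Proof. exact: measure_semi_sigma_additive. Qed.

HB.instance Definition _ := isMeasure.Build _ _ _ lebesgue_rV
  lebesgue_rV0 lebesgue_rV_ge0 lebesgue_rV_sigma_additive.

Lemma lebesgue_tuple_box m (A : 'I_m -> set T) : (forall i, measurable (A i)) ->
  lebesgue_tuple R m [set t | forall i, A i (tnth t i)] =
  (\prod_(i < m) lebesgue_measure (A i))%E.
Proof.
elim: m A => [|m IH] A mA.
  by rewrite big_ord0 /= diracE mem_set// => -[].
rewrite big_ord_recl -IH//.
have -> : lebesgue_tuple R m.+1 = lebesgue_cons (lebesgue_tuple R m) :> (_ -> _).
  by [].
rewrite /lebesgue_cons /pushforward -product_measure1E//; last first.
  rewrite (_ : [set t | _] = \big[setI/setT]_(i < m)
      ((fun t : m.-tuple T => tnth t i) @^-1` A (lift ord0 i))).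
    apply: bigsetI_measurable => i _; rewrite -[X in measurable X]setTI.
    exact: measurable_tnth.
  rewrite -bigcap_seq; apply/seteqP; split=> [t At i _|t At i]/=.
    exact: At.
  by apply: At => /=; rewrite mem_index_enum.
congr (product_measure1 _ _ _); apply/seteqP; split=> [[x t] At|[x t] [A0 At] i].
  split=> [|i] /=; first exact: (At ord0).
  by have := At (lift ord0 i); rewrite tnthS.
by case: (unliftP ord0 i) => [j ->|->]//; rewrite tnthS; exact: At.
Qed.

Lemma lebesgue_rV_box (A : 'I_n -> set T) : (forall i, measurable (A i)) ->
  lebesgue_rV [set x | forall i, A i (x ord0 i)] =
  (\prod_(i < n) lebesgue_measure (A i))%E.
Proof.
move=> mA; rewrite -lebesgue_tuple_box// /lebesgue_rV /pushforward.
by congr (lebesgue_tuple R n _); apply/seteqP; split=> t At i;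
  have := At i; rewrite mxE.
Qed.

End lebesgue_rV.

(* R^n with n >= 1 is 'rV[R]_n.+1 below: the dimension is n.+1 and there are
   n functions g. *)
Section bounded_fractional_variation.
Local Open Scope ereal_scope.
Variables (R : realType) (n : nat).
Local Notation Rn := 'rV[R]_n.+1.
Local Notation Leb := (@lebesgue_rV R n.+1).

(* Euclidean norm; the library's `|x| on row vectors is the sup norm. *)
Definition enorm (x : Rn) : R := Num.sqrt (\sum_i x ord0 i ^+ 2)%R.

Definition lip (alpha : R) (f : Rn -> R) : \bar R :=
  ereal_sup [set (`|f z.1 - f z.2| / enorm (z.1 - z.2) `^ alpha)%R%:E
            | z in [set z : Rn * Rn | z.1 != z.2]].

Definition is_lip (f : Rn -> R) : Prop := lip 1 f < +oo.

Definition fg_map (f : Rn -> R) (g : 'I_n -> Rn -> R) (x : Rn) : Rn :=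
  \row_i (if unlift ord0 i is Some j then g j x else f x).

(* For Lipschitz f and g this is the classical determinant at almost every x;
   where (f, g) is not differentiable, 'J and hence detD are 0. 'J is the
   transpose of the usual Jacobian matrix. *)
Definition detD (f : Rn -> R) (g : 'I_n -> Rn -> R) (x : Rn) : R :=
  \det ('J (fg_map f g) x).

Definition L1c (u : Rn -> R) : Prop :=
  Leb.-integrable setT (EFin \o u) /\
  exists2 K : set Rn, compact K & {ae Leb, forall x, ~ K x -> u x = 0%R}.

(* lip alpha f may be +oo. Products in \bar R use 0 * +oo = 0; for u in L1c
   this convention does not affect the infimum, because f can be truncated
   outside a bounded set. *)
Definition fvar (alpha : R) (u : Rn -> R) : \bar R :=
  ereal_inf [set C : \bar R | 0 <= C /\
    forall (f : Rn -> R) (g : 'I_n -> Rn -> R),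
      is_lip f -> (forall i, is_lip (g i)) ->
      `| \int[Leb]_x (u x * detD f g x)%:E |
        <= C * lip alpha f * \prod_(i < n) lip 1 (g i)].

Definition BVc (alpha : R) (u : Rn -> R) : Prop :=
  L1c u /\ fvar alpha u < +oo.

End bounded_fractional_variation.

(* Main.v *)
Require Import Defs.
From mathcomp Require Import all_boot all_order all_algebra.
From mathcomp Require Import all_classical all_reals all_analysis.
From mathcomp Require Import measurable_realfun ring lra.
Import Order.TTheory GRing.Theory Num.Theory.
Import numFieldNormedType.Exports.

Set Implicit Arguments.
Unset Strict Implicit.
Unset Printing Implicit Defensive.

Local Open Scope classical_set_scope.
Local Open Scope ring_scope.

(* Let N = n+1 and s = N-1+alpha. Choosing the coordinates other than x_i as
   the maps g in the definition of V^alpha(chi_B) gives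
     sum_i int_B d_i F_i <= N V^alpha(chi_B) max_i Lip^alpha(F_i).
   Take for F the convolution of chi_B with the Newton kernel x / |x|^N, whose
   divergence is a multiple of chi_B: the left-hand side is then a multiple of
   |B|, while |K(x) - K(y)| <= C |x - y|^alpha (|x|^-s + |y|^-s) and the bound
   int_B |x - y|^-s dy <= C |B|^(1 - s/N) control Lip^alpha(F). This yields the
   endpoint inequality |B|^(s/N) <= C V^alpha(chi_B), and |B| <= (2r)^N gives
   the exponents d > s.
   To obtain smooth F without differentiating under the integral sign, chi_B is
   replaced by point masses |B /\ Q| at the corners of the dyadic cubes Q of
   side h, and |x| by q = sqrt(|x|^2 + h^2). The divergence of x / q^N is
   N h^2 / q^(N+2) >= 0, so the left-hand side is at least
   c h^-N sum_Q |B /\ Q|^2, which exceeds c |B| / 2 for small h because B is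
   nearly a union of dyadic cubes. *)

(** * The regularized Newton kernel *)

Section newton_kernel.
Context (R : realType) (n : nat).
Implicit Types (h : R) (x y z : 'rV[R]_n.+1) (i : 'I_n.+1).

Definition qnorm h x : R := Num.sqrt (h ^+ 2 + \sum_i x ord0 i ^+ 2).

Definition newton h i x : R := x ord0 i * (qnorm h x ^+ n.+1)^-1.

Lemma sumsq_ge0 x : 0 <= \sum_i x ord0 i ^+ 2.
Proof. by apply: sumr_ge0 => i _; exact: sqr_ge0. Qed.

Lemma sqr_qnorm h x : qnorm h x ^+ 2 = h ^+ 2 + \sum_i x ord0 i ^+ 2.
Proof. by rewrite sqr_sqrtr// addr_ge0 ?sqr_ge0// sumsq_ge0. Qed.

Lemma qnorm_ge_h h x : 0 <= h -> h <= qnorm h x.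
Proof.
move=> h0; rewrite -[leLHS]ger0_norm// -sqrtr_sqr ler_wsqrtr//.
by rewrite lerDl sumsq_ge0.
Qed.

Lemma qnorm_gt0 h x : 0 < h -> 0 < qnorm h x.
Proof. by move=> h0; rewrite (lt_le_trans h0)// qnorm_ge_h// ltW. Qed.

Lemma ler_coord_sumsq x i : x ord0 i ^+ 2 <= \sum_j x ord0 j ^+ 2.
Proof.
by rewrite (bigD1 i)//= lerDl sumr_ge0// => j _; exact: sqr_ge0.
Qed.

Lemma ler_coord_enorm x i : `|x ord0 i| <= enorm x.
Proof. by rewrite -sqrtr_sqr ler_wsqrtr// ler_coord_sumsq. Qed.

Lemma ler_coord_qnorm h x i : `|x ord0 i| <= qnorm h x.
Proof.
by rewrite -sqrtr_sqr ler_wsqrtr// (le_trans (ler_coord_sumsq x i))// lerDr sqr_ge0.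
Qed.

Lemma enorm_ge0 x : 0 <= enorm x.
Proof. exact: sqrtr_ge0. Qed.

Lemma enorm_gt0 x : x != 0 -> 0 < enorm x.
Proof.
move=> x0; rewrite lt_neqAle enorm_ge0 andbT eq_sym; apply: contra x0 => /eqP e.
apply/eqP/rowP => i; rewrite mxE; apply/eqP.
by rewrite -normr_le0 -e ler_coord_enorm.
Qed.

Lemma enormN x : enorm (- x) = enorm x.
Proof. by congr Num.sqrt; apply: eq_bigr => i _; rewrite mxE sqrrN. Qed.

(** Multiplying by the sum of the two norms turns the left-hand side into the sum of the products
    (x_i - y_i)(x_i + y_i), whose second factors are at most that sum. Estimating the products one
    at a time costs the factor [n.+1]. *)
Lemma qnorm_lip h x y : 0 < h ->
  `|qnorm h x - qnorm h y| <= n.+1%:R * enorm (x - y).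
Proof.
move=> h0; have qq : 0 < qnorm h x + qnorm h y by rewrite addr_gt0 ?qnorm_gt0.
rewrite -(ler_pM2r qq) -[in leLHS](gtr0_norm qq) -normrM.
have -> : (qnorm h x - qnorm h y) * (qnorm h x + qnorm h y) =
    \sum_i (x ord0 i - y ord0 i) * (x ord0 i + y ord0 i).
  rewrite -subr_sqr !sqr_qnorm.
  under [in RHS]eq_bigr do rewrite -subr_sqr.
  by rewrite sumrB; ring.
rewrite (le_trans (ler_norm_sum _ _ _))//.
rewrite -mulrA mulr_natl -[X in _ *+ X](card_ord n.+1) -sumr_const ler_sum// => i _.
rewrite normrM ler_pM//.
  by have := ler_coord_enorm (x - y) i; rewrite !mxE.
by rewrite (le_trans (ler_normD _ _))// lerD// ler_coord_qnorm.
Qed.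

(** Induction through 1 - t^(N+1) = (1 - t) + t (1 - t^N). It serves with t a ratio of two values of
    [qnorm h]. *)
Lemma onemX_le (t : R) N : 0 <= t <= 1 -> 1 - t ^+ N <= N%:R * (1 - t).
Proof.
move=> /andP[t0 t1]; elim: N => [|N IH]; first by rewrite expr0 mul0r subrr.
have tN : t ^+ N <= 1 by rewrite exprn_ile1.
rewrite -natr1 exprS.
have : t * (1 - t ^+ N) <= 1 - t ^+ N by rewrite ler_piMl// subr_ge0.
lra.
Qed.

Lemma newton_bound h x i : 0 < h -> `|newton h i x| <= (qnorm h x ^+ n)^-1.
Proof.
move=> h0; have q0 := qnorm_gt0 x h0.
rewrite /newton normrM [X in _ * X]ger0_norm ?invr_ge0 ?exprn_ge0 ?(ltW q0)//.
rewrite exprS invfM mulrA ler_piMl ?invr_ge0 ?exprn_ge0 ?(ltW q0)//.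
by rewrite ler_pdivrMr// mul1r ler_coord_qnorm.
Qed.

(** With a <= b the two values of [qnorm h] and N = n+1, the difference is (x_i - y_i) / b^N + x_i
    (a^-N - b^-N). In the second term [onemX_le] at a / b and [qnorm_lip] each give a factor N; the
    summand 1 comes from the first term. One power is left on b, so that the ratio |x - y| / b
    appears. *)
Let newton_lip_le h x y i : 0 < h -> qnorm h x <= qnorm h y ->
  `|newton h i x - newton h i y| <=
  (n.+1%:R ^+ 2 + 1) * enorm (x - y) * (qnorm h x ^+ n)^-1 * (qnorm h y)^-1.
Proof.
move=> h0 ab; rewrite /newton.
have := qnorm_lip x y h0; rewrite distrC => lipq.
have a0 := qnorm_gt0 x h0; have b0 := qnorm_gt0 y h0.
have xa := ler_coord_qnorm h x i.
have := ler_coord_enorm (x - y) i; rewrite !mxE.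
move: (x ord0 i) (y ord0 i) xa => u v.
move: (qnorm h x) (qnorm h y) (enorm (x - y)) ab lipq a0 b0 => a b D ab.
rewrite ger0_norm ?subr_ge0// => bad a0 b0 ua uv.
have D0 : 0 <= D by exact: le_trans uv.
have -> : u * (a ^+ n.+1)^-1 - v * (b ^+ n.+1)^-1 =
   (u - v) * (b ^+ n.+1)^-1 + u * ((a ^+ n.+1)^-1 * (1 - (a / b) ^+ n.+1)).
  rewrite expr_div_n; field.
  by rewrite !expf_neq0 ?gt_eqF.
have ab1 : 0 <= a / b <= 1.
  by rewrite divr_ge0 ?(ltW a0) ?(ltW b0)//= ler_pdivrMr// mul1r.
have abN : 0 <= 1 - (a / b) ^+ n.+1.
  by case/andP: ab1 => ? ?; rewrite subr_ge0 exprn_ile1.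
rewrite (le_trans (ler_normD _ _))// !normrM.
rewrite (ger0_norm (_ : 0 <= (b ^+ n.+1)^-1)) ?invr_ge0 ?exprn_ge0 ?(ltW b0)//.
rewrite (ger0_norm (_ : 0 <= (a ^+ n.+1)^-1)) ?invr_ge0 ?exprn_ge0 ?(ltW a0)//.
rewrite (ger0_norm abN).
rewrite [X in _ <= X](_ : _ = D * ((a ^+ n)^-1 / b) +
    a * ((a ^+ n.+1)^-1 * (n.+1%:R * (n.+1%:R * D / b)))); last first.
  rewrite (exprS a); field; by rewrite expf_neq0 ?gt_eqF.
rewrite lerD//.
  apply: ler_pM => //; first by rewrite invr_ge0 exprn_ge0// ltW.
  rewrite exprSr invfM ler_wpM2r ?invr_ge0 ?(ltW b0)//.
  by rewrite lef_pV2 ?posrE ?exprn_gt0// lerXn2r ?nnegrE ?(ltW a0) ?(ltW b0).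
apply: ler_pM => //; first by rewrite mulr_ge0 ?invr_ge0 ?exprn_ge0 ?(ltW a0).
rewrite ler_wpM2l ?invr_ge0 ?exprn_ge0 ?(ltW a0)//.
rewrite (le_trans (onemX_le _ ab1))// ler_wpM2l//.
rewrite (_ : 1 - a / b = (b - a) / b); last by field; rewrite gt_eqF.
by rewrite ler_wpM2r// invr_ge0 ltW.
Qed.

(** Interpolation between the Lipschitz bound and the trivial bound 2 a^-n, according to the ratio
    |x - y| / b. A ratio at most 1 does not decrease when raised to the power al; a larger one has
    power at least 1, and the constant in front is at least 2. *)
Let newton_holder_le h x y i (al : R) : 0 < h -> 0 <= al <= 1 ->
  qnorm h x <= qnorm h y ->
  `|newton h i x - newton h i y| <=
  (n.+1%:R ^+ 2 + 1) * enorm (x - y) `^ al * (qnorm h x) `^ (- (n%:R + al)).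
Proof.
move=> h0 /andP[al0 al1] ab.
have a0 := qnorm_gt0 x h0; have b0 := qnorm_gt0 y h0.
have H1 := newton_lip_le i h0 ab.
have H2 : `|newton h i x - newton h i y| <= 2 * (qnorm h x ^+ n)^-1.
  apply: (le_trans (ler_normB _ _)); rewrite mulr_natl mulr2n.
  apply: lerD; first exact: newton_bound.
  apply: (le_trans (newton_bound y i h0)).
  by rewrite lef_pV2 ?posrE ?exprn_gt0// lerXn2r ?nnegrE ?(ltW a0) ?(ltW b0).
set M := n.+1%:R ^+ 2 + 1 : R in H1 *.
have M2 : 2 <= M.
  have : 1 <= (n.+1%:R : R) ^+ 2 by rewrite exprn_ege1// ler1n.
  rewrite /M; lra.
have D0 := enorm_ge0 (x - y).
move: (`|_ - _|) (qnorm h x) (qnorm h y) (enorm (x - y)) ab a0 b0 D0 H1 H2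
  => X a b D ab a0 b0 D0 H1 H2.
have key : X <= (a ^+ n)^-1 * (M * (D / b) `^ al).
  have an : 0 <= (a ^+ n)^-1 by rewrite invr_ge0 exprn_ge0// ltW.
  have [tb|tb] := leP (D / b) 1.
    apply: (le_trans H1).
    rewrite [leLHS](_ : _ = (a ^+ n)^-1 * (M * (D / b))); last by ring.
    rewrite ler_wpM2l// ler_wpM2l ?(le_trans _ M2)//.
    have [->|t0] := eqVneq (D / b) 0; first exact: powR_ge0.
    rewrite -[leLHS]powRr1 ?divr_ge0 ?(ltW b0)//.
    by rewrite ger_powR// tb andbT lt_neqAle eq_sym t0 divr_ge0 ?(ltW b0).
  apply: (le_trans H2); rewrite mulrC ler_wpM2l// (le_trans M2)//.
  rewrite ler_peMr ?(le_trans _ M2)//.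
  by rewrite -(powRr0 (D / b)) ler_powR// ltW.
apply: (le_trans key).
rewrite powRM ?invr_ge0 ?(ltW b0)//.
have -> : b^-1 `^ al = b `^ (- al).
  by rewrite -(powR_inv1 (ltW b0)) -powRrM mulN1r.
rewrite opprD powRD; last by rewrite (gt_eqF a0) implybT.
rewrite (powRN a n%:R) powR_mulrn ?(ltW a0)//.
rewrite [leLHS](_ : _ = M * D `^ al * ((a ^+ n)^-1 * b `^ (- al))); last by ring.
rewrite ler_wpM2l ?mulr_ge0 ?powR_ge0 ?(le_trans _ M2)//.
rewrite ler_wpM2l ?invr_ge0 ?exprn_ge0 ?(ltW a0)//.
by rewrite !powRN lef_pV2 ?posrE ?powR_gt0// ge0_ler_powR ?nnegrE ?(ltW a0) ?(ltW b0).
Qed.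

(* [al = 1] gives the Lipschitz bound, as [qnorm h] is bounded below by [h]. *)
Lemma newton_holder h x y i (al : R) : 0 < h -> 0 <= al <= 1 ->
  `|newton h i x - newton h i y| <=
  (n.+1%:R ^+ 2 + 1) * enorm (x - y) `^ al *
  (qnorm h x `^ (- (n%:R + al)) + qnorm h y `^ (- (n%:R + al))).
Proof.
move=> h0 al01.
have M0 (D : R) : 0 <= (n.+1%:R ^+ 2 + 1) * D `^ al.
  by rewrite mulr_ge0 ?powR_ge0// addr_ge0 ?sqr_ge0.
have [ab|/ltW ba] := leP (qnorm h x) (qnorm h y).
  rewrite (le_trans (newton_holder_le i h0 al01 ab))// ler_wpM2l//.
  by rewrite lerDl powR_ge0.
rewrite distrC -(enormN (x - y)) opprB.
rewrite (le_trans (newton_holder_le i h0 al01 ba))// ler_wpM2l//.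
by rewrite lerDr powR_ge0.
Qed.

End newton_kernel.

(** * Partial derivatives and divergence of the kernel *)

Section newton_derivative.
Context (R : realType) (n : nat).
Local Notation Rn := 'rV[R]_n.+1.
Implicit Types (x y v : Rn) (i : 'I_n.+1).

Lemma is_derive_comp1 (f : Rn -> R) (g : R -> R) x v (df dg : R) :
  differentiable f x -> is_derive x v f df -> is_derive (f x) 1 g dg ->
  is_derive x v (g \o f) (dg * df).
Proof.
move=> Df fdf gdg.
have Dg : differentiable g (f x) by apply/derivable1_diffP; exact: ex_derive.
apply: DeriveDef; first exact/diff_derivable/differentiable_comp.
rewrite deriveE; last exact: differentiable_comp.
rewrite (diff_comp Df Dg) /= -(deriveE _ Df) (diff1E Dg) derive1E !derive_val.
exact: mulrC.
Qed.

Lemma is_derive_coord i x v : is_derive x v (fun z : Rn => z ord0 i) (v ord0 i).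
Proof.
apply: DeriveDef; first exact/diff_derivable/differentiable_coord.
have dv : derivable (id : Rn -> Rn) x v by exact: derivable_id.
have := derive_mx dv; rewrite derive_id => /matrixP/(_ ord0 i).
by rewrite mxE.
Qed.

Definition unit_vec i : Rn := delta_mx ord0 i.

Definition dnewton h i x : R :=
  (qnorm h x ^+ n.+1)^-1 - n.+1%:R * x ord0 i ^+ 2 / qnorm h x ^+ n.+3.

(** The radicand is written as a sum of functions, the form to which the differentiation rules
    apply. The term [h ^+ 2] keeps it positive, where the square root is differentiable. *)
Let qsq h y : Rn -> R :=
  cst (h ^+ 2) + \sum_(j < n.+1) (fun z : Rn => z ord0 j - y ord0 j) ^+ 2.

Let qnormE h y : (fun z : Rn => qnorm h (z - y)) = Num.sqrt \o qsq h y.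
Proof.
apply/funext => z; rewrite /qnorm/= /qsq; congr Num.sqrt.
rewrite /GRing.add/= fct_sumE; congr (_ + _); apply: eq_bigr => j _.
by rewrite !mxE.
Qed.

Let qsq_gt0 h y x : 0 < h -> 0 < qsq h y x.
Proof.
move=> h0; rewrite -sqrtr_gt0; have := congr1 (@^~ x) (qnormE h y).
by move=> /= <-; exact: qnorm_gt0.
Qed.

Let differentiable_qsq h y x : differentiable (qsq h y) x.
Proof.
apply: differentiableD; first exact: differentiable_cst.
apply: differentiable_sum => j; apply: differentiableX.
apply: differentiableB; first exact: differentiable_coord.
exact: differentiable_cst.
Qed.

Lemma differentiable_qnorm h y x : 0 < h ->
  differentiable (fun z : Rn => qnorm h (z - y)) x.
Proof.
move=> h0; rewrite qnormE; apply: differentiable_comp => //.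
apply/derivable1_diffP.
exact: (@ex_derive _ _ _ _ _ _ _ (is_derive1_sqrt (qsq_gt0 y x h0))).
Qed.

Lemma is_derive_qnorm h i y x : 0 < h ->
  is_derive x (unit_vec i) (fun z : Rn => qnorm h (z - y))
    ((x - y) ord0 i / qnorm h (x - y)).
Proof.
move=> h0; have qx : qnorm h (x - y) = Num.sqrt (qsq h y x).
  by have := congr1 (@^~ x) (qnormE h y).
rewrite qnormE.
have dq : is_derive x (unit_vec i) (qsq h y) (2 * (x - y) ord0 i).
  have dc j : is_derive x (unit_vec i) (fun z : Rn => z ord0 j - y ord0 j) ((i == j)%:R).
    have := is_deriveB (is_derive_coord j x (unit_vec i))
      (is_derive_cst (y ord0 j) x (unit_vec i)).
    by rewrite subr0 mxE eqxx eq_sym.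
  have := is_deriveD (is_derive_cst (h ^+ 2) x (unit_vec i))
     (is_derive_sum (fun j => is_deriveX 2 (dc j))).
  move=> /is_derive_eq; apply.
  rewrite add0r (bigD1 i)//= big1 => [|j ji]; last first.
    by rewrite eq_sym (negbTE ji) scaler0.
  by rewrite eqxx addr0 expr1 !mxE /GRing.scale/= mulr1.
have := is_derive_comp1 (differentiable_qsq h y x) dq (is_derive1_sqrt (qsq_gt0 y x h0)).
rewrite -qx => /is_derive_eq; apply.
by field; rewrite gt_eqF// qnorm_gt0.
Qed.

Lemma differentiable_newton h i y x : 0 < h ->
  differentiable (fun z : Rn => newton h i (z - y)) x.
Proof.
move=> h0; rewrite (_ : (fun z => _) = (fun z : Rn => z ord0 i - y ord0 i) *
    (fun z => (((fun z => qnorm h (z - y)) ^+ n.+1) z)^-1)); last first.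
  by apply/funext => z; rewrite mulrfctE exprfctE /newton !mxE.
apply: differentiableM.
  by apply: differentiableB; [exact: differentiable_coord|exact: differentiable_cst].
apply: differentiableV; first exact/differentiableX/differentiable_qnorm.
by rewrite exprfctE gt_eqF// exprn_gt0// qnorm_gt0.
Qed.

Lemma is_derive_newton h i y x : 0 < h ->
  is_derive x (unit_vec i) (fun z : Rn => newton h i (z - y)) (dnewton h i (x - y)).
Proof.
move=> h0; rewrite (_ : (fun z => _) = (fun z : Rn => z ord0 i - y ord0 i) *
    (fun z => (((fun z => qnorm h (z - y)) ^+ n.+1) z)^-1)); last first.
  by apply/funext => z; rewrite mulrfctE exprfctE /newton !mxE.
have q0 : 0 < qnorm h (x - y) by exact: qnorm_gt0.
have dc : is_derive x (unit_vec i) (fun z : Rn => z ord0 i - y ord0 i) 1.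
  have := is_deriveB (is_derive_coord i x (unit_vec i))
    (is_derive_cst (y ord0 i) x (unit_vec i)).
  by rewrite subr0 mxE !eqxx.
have dN := is_deriveX n.+1 (is_derive_qnorm i y x h0).
set f : Rn -> R := (fun z => qnorm h (z - y)) ^+ n.+1 in dN *.
have fx : f x = qnorm h (x - y) ^+ n.+1 by rewrite /f exprfctE.
have f0 : f x != 0 by rewrite fx gt_eqF// exprn_gt0.
have dV : is_derive x (unit_vec i) (fun z => (f z)^-1)
    (- (f x) ^- 2 *: 'D_(unit_vec i) f x).
  by apply: DeriveDef; [exact: derivableV (ex_derive)|exact: deriveV (ex_derive)].
have := is_deriveM dc dV; move=> /is_derive_eq; apply.
rewrite (derive_val) fx /dnewton /GRing.scale/= !mxE !exprS.
move: (qnorm _ _) q0 => q q0.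
by field; rewrite !gt_eqF// exprn_gt0.
Qed.

Lemma continuous_dnewton h i y : 0 < h -> continuous (fun x : Rn => dnewton h i (x - y)).
Proof.
move=> h0 x; rewrite /dnewton.
have cq : {for x, continuous (fun z : Rn => qnorm h (z - y))}.
  by apply: differentiable_continuous; exact: differentiable_qnorm.
have q0 N : qnorm h (x - y) ^+ N != 0 by rewrite gt_eqF// exprn_gt0// qnorm_gt0.
have cX N : {for x, continuous (fun z : Rn => (qnorm h (z - y) ^+ N)^-1)}.
  apply: continuousV; first exact: q0.
  exact: (continuous_comp cq (@exprn_continuous _ N _)).
have cc : {for x, continuous (fun z : Rn => (z - y) ord0 i)}.
  rewrite (_ : (fun z : Rn => _) = (fun z => z ord0 i - y ord0 i)).
    by apply: continuousB; [exact: coord_continuous|exact: cst_continuous].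
  by apply/funext => z; rewrite !mxE.
have cc2 : {for x, continuous (fun z : Rn => (z - y) ord0 i ^+ 2)}.
  exact: (continuous_comp cc (@exprn_continuous _ 2 _)).
have c1 : {for x, continuous (fun _ : Rn => n.+1%:R : R)} by exact: cst_continuous.
exact: (continuousB (cX n.+1) (continuousM (continuousM c1 cc2) (cX n.+3))).
Qed.

(** This bound serves only for integrability at a fixed level of the grid, so its growth as h tends
    to 0 is harmless. *)
Lemma dnewton_le h i x : 0 < h -> `|dnewton h i x| <= n.+2%:R / h ^+ n.+1.
Proof.
move=> h0; have q0 : 0 < qnorm h x by exact: qnorm_gt0.
have qN : (qnorm h x ^+ n.+1)^-1 <= (h ^+ n.+1)^-1.
  rewrite lef_pV2 ?posrE ?exprn_gt0// lerXn2r ?nnegrE ?(ltW h0) ?(ltW q0)//.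
  by rewrite qnorm_ge_h// ltW.
rewrite -[n.+2%:R]natr1 mulrDl mul1r addrC.
rewrite (le_trans (ler_normB _ _))// lerD//.
  by rewrite ger0_norm// invr_ge0 exprn_ge0// ltW.
have := ler_coord_qnorm h x i; move: (qnorm h x) (x ord0 i) q0 qN => q u q0 qN uq.
rewrite ger0_norm; last first.
  apply: mulr_ge0; last by rewrite invr_ge0 exprn_ge0// ltW.
  by apply: mulr_ge0; rewrite ?sqr_ge0.
rewrite -mulrA ler_wpM2l//; apply: le_trans qN.
rewrite ler_pdivrMr ?exprn_gt0//.
have -> : (q ^+ n.+1)^-1 * q ^+ n.+3 = q ^+ 2.
  by rewrite -[n.+3]addn2 exprD mulKf// expf_neq0// gt_eqF.
by rewrite -[leLHS]real_normK ?num_real// lerXn2r ?nnegrE// ltW.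
Qed.

(** This is the divergence of x / q^N with N = n+1: since |x|^2 = q^2 - h^2, the terms N / q^N
    cancel. What remains is positive and of order h^-N at distances up to h, a smooth substitute for
    the Dirac mass of the singular kernel. *)
Lemma sum_dnewton h x : 0 < h ->
  \sum_i dnewton h i x = n.+1%:R * h ^+ 2 / qnorm h x ^+ n.+3.
Proof.
move=> h0; have q0 : 0 < qnorm h x by exact: qnorm_gt0.
rewrite sumrB sumr_const card_ord -mulr_suml -mulr_sumr.
have -> : \sum_i x ord0 i ^+ 2 = qnorm h x ^+ 2 - h ^+ 2.
  by rewrite sqr_qnorm addrC addKr.
rewrite -mulr_natl !exprS; move: (qnorm _ _) q0 => q q0.
by field; rewrite !gt_eqF// exprn_gt0.
Qed.

End newton_derivative.

(** * Test maps *)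

Section test_maps.
Context (R : realType) (n : nat).
Local Notation Rn := 'rV[R]_n.+1.
Local Notation Leb := (@lebesgue_rV R n.+1).
Implicit Types (x y v : Rn) (i : 'I_n.+1) (f : Rn -> R).

Definition other_coords i (j : 'I_n) (x : Rn) : R := x ord0 (lift i j).

Lemma differentiable_fg_map f (g : 'I_n -> Rn -> R) x :
  differentiable f x -> (forall j, differentiable (g j) x) ->
  differentiable (fg_map f g) x.
Proof.
move=> df dg.
pose comp (l : 'I_n.+1) : Rn -> R := if unlift ord0 l is Some j then g j else f.
have -> : fg_map f g = \sum_(l < n.+1) (fun z => comp l z *: (delta_mx ord0 l : Rn)).
  apply/funext => z; rewrite fct_sumE [LHS]row_sum_delta; apply: eq_bigr => l _.
  by congr (_ *: _); rewrite mxE /comp; case: unliftP.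
apply: differentiable_sum => l; apply: differentiableZl.
by rewrite /comp; case: unliftP.
Qed.

(** Rows of ['J] are directions and columns are components. The coordinates other than x_i do not
    vary in direction i, so row i is zero except for the derivative of f in column 0. Deleting that
    row and column leaves the identity matrix, and the sign is that of the cofactor. *)
Lemma detD_other_coords f i x : differentiable f x ->
  detD f (other_coords i) x = (-1) ^+ i * 'D_(unit_vec R i) f x.
Proof.
move=> df.
have dfg : differentiable (fg_map f (other_coords i)) x.
  by apply: differentiable_fg_map => // j; exact: differentiable_coord.
have JE k l : ('J (fg_map f (other_coords i)) x) k l =
    if unlift ord0 l is Some j then (k == lift i j)%:R else 'D_(unit_vec R k) f x.
  have := deriveEjacobian (unit_vec R k) dfg.
  rewrite derive_mx; last exact: diff_derivable.
  rewrite -rowE => /rowP/(_ l); rewrite !mxE => <-.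
  case: (unliftP ord0 l) => [j ->|->].
    rewrite (_ : (fun t => _) = (fun z : Rn => z ord0 (lift i j))); last first.
      by apply/funext => z; rewrite mxE liftK.
    rewrite (@derive_val _ _ _ _ _ _ _ (is_derive_coord _ _ _)).
    by rewrite mxE eqxx eq_sym.
  rewrite (_ : (fun t => _) = f)//.
  by apply/funext => z; rewrite mxE unlift_none.
rewrite /detD (expand_det_row _ i) big_ord_recl big1 ?addr0 => [|j _]; last first.
  by rewrite JE liftK (negbTE (neq_lift _ _)) mul0r.
rewrite JE unlift_none mulrC; congr (_ * _).
rewrite /cofactor addn0 -[RHS]mulr1; congr (_ * _).
rewrite (_ : row' _ _ = 1%:M) ?det1//.
apply/matrixP => a b; rewrite [LHS]mxE [LHS]mxE JE liftK [RHS]mxE.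
by rewrite (inj_eq lift_inj).
Qed.

Lemma lip_le (al L : R) f :
  (forall x y, `|f x - f y| <= L * enorm (x - y) `^ al) -> (lip al f <= L%:E)%E.
Proof.
move=> fL; apply: ge_ereal_sup => _ [z /= z12 <-]; rewrite lee_fin.
by rewrite ler_pdivrMr// powR_gt0 ?enorm_gt0// subr_eq0.
Qed.

(** The supremum is over a nonempty set, since in positive dimension the points 0 and (1, ..., 1)
    are distinct. *)
Lemma lip_ge0 (al : R) f : (0 <= lip al f)%E.
Proof.
apply: (@le_trans _ _ (`|f (const_mx 1) - f 0| / enorm (const_mx 1 - 0) `^ al)%R%:E).
  by rewrite lee_fin divr_ge0// powR_ge0.
apply: ereal_sup_ubound; exists (const_mx 1, 0) => //=.
by apply/eqP => /matrixP/(_ ord0 ord0)/eqP; rewrite !mxE oner_eq0.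
Qed.

Lemma lip_other_coords i j : (lip 1 (other_coords i j) <= 1)%E.
Proof.
apply: lip_le => x y; rewrite mul1r powRr1 ?enorm_ge0//.
by have := ler_coord_enorm (x - y) (lift i j); rewrite !mxE.
Qed.

(** After division by L, the left-hand side is a lower bound of every constant C admissible in the
    infimum, because the factors [lip 1 (g j)] have product at most 1. *)
Lemma fvar_test (al L : R) (u : Rn -> R) f (g : 'I_n -> Rn -> R) :
  0 < L -> is_lip f -> (forall x y, `|f x - f y| <= L * enorm (x - y) `^ al) ->
  (forall j, lip 1 (g j) <= 1)%E ->
  (`| \int[Leb]_x (u x * detD f g x)%:E | <= fvar al u * L%:E)%E.
Proof.
move=> L0 lf fL gL; rewrite -lee_pdivrMr//; apply: le_ereal_inf_tmp.
move=> C [C0 HC]; rewrite lee_pdivrMr//.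
apply: le_trans (HC f g lf _) _.
  by move=> j; rewrite /is_lip (le_lt_trans (gL j))// ltry.
rewrite -[leRHS]mule1 lee_pmul//.
- by rewrite mule_ge0// lip_ge0.
- by apply: prode_ge0 => j _; exact: lip_ge0.
- by rewrite lee_wpmul2l//; exact: lip_le.
- have : (0 <= \prod_(j < n) lip 1 (g j) <= 1)%E.
    elim/big_ind : _ => [|a b /andP[a0 a1] /andP[b0 b1]|j _].
    + by rewrite lee01 lexx.
    + by rewrite mule_ge0//= -[leRHS]mule1 lee_pmul.
    + by rewrite lip_ge0 gL.
  by case/andP.
Qed.

End test_maps.

(** * Dyadic grids *)

Section dyadic_grid.
Context (R : realType) (n : nat).
Local Notation Rn := 'rV[R]_n.+1.
Local Notation Leb := (@lebesgue_rV R n.+1).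

Lemma open_measurable_rV (U : set Rn) : open U -> measurable U.
Proof. by move=> oU; exact: sub_sigma_algebra. Qed.

Lemma continuous_measurable_rV (f : Rn -> R) :
  continuous f -> measurable_fun setT f.
Proof.
move=> /continuousP cf; apply: (measurability _ (RGenOpens.measurableE R)).
move=> _ [_ [a [b ->] <-]]; rewrite setTI; apply: open_measurable_rV.
exact/cf/interval_open.
Qed.

Lemma measurable_coord_box (A : 'I_n.+1 -> set (measurableTypeR R)) :
  (forall i, measurable (A i)) ->
  measurable [set x : Rn | forall i, A i (x ord0 i)].
Proof.
move=> mA; rewrite (_ : [set x | _] =
    \big[setI/setT]_(i < n.+1) ((fun x : Rn => x ord0 i) @^-1` A i)).
  apply: bigsetI_measurable => i _; rewrite -[X in measurable X]setTI.
  apply: (@continuous_measurable_rV (fun x : Rn => x ord0 i)) => //.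
    exact: coord_continuous.
  exact: mA.
rewrite -bigcap_seq; apply/seteqP; split=> [x Ax i _|x Ax i]/=; first exact: Ax.
by apply: Ax => /=; rewrite mem_index_enum.
Qed.

Lemma measure_finType_bigcup d (T : measurableType d)
    (mu : {measure set T -> \bar R}) (I : finType) (P : pred I) (F : I -> set T) :
  (forall i, measurable (F i)) -> trivIset setT F ->
  mu (\bigcup_(i in [set i | P i]) F i) = (\sum_(i | P i) mu (F i))%E.
Proof.
move=> mF tF; rewrite measure_fin_bigcup//.
- rewrite (@bigfs _ _ _ _ (index_enum I) P) ?index_enum_uniq// => i.
    by rewrite mem_index_enum.
- exact: finite_finset.
- exact: sub_trivIset tF.
Qed.

(** Continuity from above: the differences decrease to the empty set and have finite measure. *)
Lemma nondecreasing_setD_lt d (T : measurableType d)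
    (mu : {measure set T -> \bar R}) (F : (set T)^nat) (e : R) :
  (forall i, measurable (F i)) -> nondecreasing_seq F ->
  (mu (\bigcup_i F i) < +oo)%E -> 0 < e ->
  exists i, (mu ((\bigcup_i F i) `\` F i) < e%:E)%E.
Proof.
move=> mF ndF Foo e0; apply/not_existsP => H.
have mU : measurable (\bigcup_i F i) by exact: bigcupT_measurable.
pose G i := (\bigcup_i F i) `\` F i.
have mG i : measurable (G i) by exact: measurableD.
have G0 : \bigcap_i G i = set0.
  apply/seteqP; split=> // x Gx; have [[j _ Fj] _] := Gx 0%N I.
  by have [_] := Gx j I.
have : mu \o G @ \oo --> mu (\bigcap_i G i).
  apply: nonincreasing_cvg_mu => //.
  - by rewrite (le_lt_trans _ Foo)// le_measure ?inE//; exact: subDsetl.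
  - by rewrite G0.
  - move=> i j ij; apply/subsetPset; apply: setDS; apply/subsetPset; exact: ndF.
rewrite G0 measure0 => cG.
have : (e%:E <= limn (mu \o G))%E.
  apply: lime_ge; first by apply/cvg_ex; exists 0%E.
  by apply: nearW => i; rewrite leNgt; apply/negP/H.
by rewrite (cvg_lim _ cG)// lee_fin leNgt e0.
Qed.

Definition mesh k : R := (2 ^+ k)^-1.

(** The cube [-m, m[^N has side 2m, hence 2m 2^k cells of side 2^-k along each axis. *)
Definition gidx m k : finType := {ffun 'I_n.+1 -> 'I_(m.*2 * 2 ^ k)}.

Definition corner m k (c : gidx m k) : Rn :=
  \row_i ((c i)%:R * mesh k - m%:R).

(** Cells are half-open, so that those of one level partition [gbox m] exactly. *)
Definition cell m k (c : gidx m k) : set Rn :=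
  [set x | forall i, 0 <= x ord0 i - corner c ord0 i < mesh k].

Definition gbox m : set Rn := [set x | forall i, - m%:R <= x ord0 i < m%:R].

Definition cells m k (P : pred (gidx m k)) : set Rn :=
  \bigcup_(c in [set c | P c]) cell c.

Lemma mesh_gt0 k : 0 < mesh k.
Proof. by rewrite invr_gt0 exprn_gt0. Qed.

Lemma mesh_le k l : (k <= l)%N -> mesh l <= mesh k.
Proof.
by move=> kl; rewrite lef_pV2 ?posrE ?exprn_gt0// ler_eXn2l// ltr1n.
Qed.

Lemma mesh_lt (e : R) : 0 < e -> exists k, mesh k < e.
Proof.
move=> e0; exists (Num.truncn e^-1).+1.
rewrite invf_plt ?posrE ?exprn_gt0//.
rewrite (lt_le_trans (truncnS_gt _))// -natrX ler_nat.
exact/ltnW/ltn_expl.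
Qed.

Lemma measurable_cell m k (c : gidx m k) : measurable (cell c).
Proof.
pose A i : set (measurableTypeR R) :=
  [set` `[corner c ord0 i, corner c ord0 i + mesh k[].
rewrite (_ : cell c = [set x : Rn | forall i, A i (x ord0 i)]).
  by apply: measurable_coord_box => i; exact: measurable_itv.
apply/seteqP; split=> x cx i; have := cx i;
  by rewrite /A /= in_itv/= subr_ge0 ltrBlDl.
Qed.

Lemma lebesgue_cell m k (c : gidx m k) : Leb (cell c) = (mesh k ^+ n.+1)%:E.
Proof.
pose A i : set (measurableTypeR R) :=
  [set` `[corner c ord0 i, corner c ord0 i + mesh k[].
rewrite (_ : cell c = [set x : Rn | forall i, A i (x ord0 i)]).
  rewrite lebesgue_rV_box; last by move=> i; exact: measurable_itv.
  under eq_bigr => i _.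
    rewrite lebesgue_measure_itv/= lte_fin ltrDl mesh_gt0 -EFinB addrAC subrr add0r.
    over.
  by rewrite prodEFin prodr_const card_ord.
apply/seteqP; split=> x cx i; have := cx i;
  by rewrite /A /= in_itv/= subr_ge0 ltrBlDl.
Qed.

Lemma measurable_gbox m : measurable (gbox m).
Proof.
pose A (i : 'I_n.+1) : set (measurableTypeR R) := [set` `[- m%:R, m%:R[].
rewrite (_ : gbox m = [set x : Rn | forall i, A i (x ord0 i)]).
  by apply: measurable_coord_box => i; exact: measurable_itv.
by apply/seteqP; split=> x cx i; have := cx i; rewrite /A /= in_itv.
Qed.

Lemma lebesgue_gbox m : Leb (gbox m) = ((m.*2%:R) ^+ n.+1)%:E.
Proof.
pose A (i : 'I_n.+1) : set (measurableTypeR R) := [set` `[- m%:R, m%:R[].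
rewrite (_ : gbox m = [set x : Rn | forall i, A i (x ord0 i)]).
  rewrite lebesgue_rV_box; last by move=> i; exact: measurable_itv.
  under eq_bigr => i _.
    rewrite (_ : lebesgue_measure _ = m.*2%:R%:E); first over.
    rewrite lebesgue_measure_itv/= lte_fin -EFinB opprK -natrD addnn.
    case: ifPn => //; rewrite -leNgt -subr_ge0 -opprD -natrD addnn.
    by rewrite oppr_ge0 lern0 => /eqP ->.
  by rewrite prodEFin prodr_const card_ord.
by apply/seteqP; split=> x cx i; have := cx i; rewrite /A /= in_itv.
Qed.

Lemma trivIset_cell m k : trivIset setT (@cell m k).
Proof.
move=> c c' _ _ [x [cx c'x]]; apply/ffunP => i; apply/val_inj => /=.
(* With h the mesh, a_i h <= x_i + m < (b_i + 1) h; exchanging a and b then gives equality of the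
   integers. *)
have lt1 (a b : gidx m k) : cell a x -> cell b x -> (a i < (b i).+1)%N.
  move=> /(_ i)/andP[+ _] /(_ i)/andP[_]; rewrite !mxE => bx ax.
  have : (a i)%:R * mesh k < (b i).+1%:R * mesh k.
    rewrite -natr1; lra.
  by rewrite ltr_pM2r ?mesh_gt0// ltr_nat.
by apply/eqP; rewrite eqn_leq; apply/andP; split; rewrite -ltnS; exact: lt1.
Qed.

Lemma gbox_cell m k x : gbox m x -> exists c : gidx m k, cell c x.
Proof.
move=> bx.
(* The distance to the face x_i = -m in units of the mesh; its integer part is the index of the
   cell. *)
pose t i : R := (x ord0 i + m%:R) * 2 ^+ k.
have t0 i : 0 <= t i.
  have /andP[? _] := bx i; rewrite mulr_ge0 ?exprn_ge0//; lra.
have tm i : (Num.truncn (t i) < m.*2 * 2 ^ k)%N.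
  rewrite -(ltr_nat R) (@le_lt_trans _ _ (t i)) ?truncn_le// natrM natrX.
  rewrite ltr_pM2r ?exprn_gt0//.
  have /andP[_ ?] := bx i; rewrite -addnn natrD; lra.
exists [ffun i => Ordinal (tm i)] => i; rewrite mxE ffunE/=.
have -> : x ord0 i = t i * mesh k - m%:R.
  by rewrite /t -mulrA divff ?mulr1 ?addrK// expf_neq0.
rewrite opprB addrA addrNK -mulrBl mulr_ge0 ?(ltW (mesh_gt0 _))//=.
  by rewrite gtr_pMl ?mesh_gt0// ltrBlDr addrC natr1 truncnS_gt.
by rewrite subr_ge0 truncn_le.
Qed.

Lemma cell_gbox m k (c : gidx m k) : cell c `<=` gbox m.
Proof.
move=> x cx i; have := cx i; rewrite mxE => /andP[c1 c2].
have p0 := mesh_gt0 k.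
have : 0 <= (c i)%:R * mesh k by rewrite mulr_ge0 ?(ltW p0).
have : (c i).+1%:R * mesh k <= m%:R + m%:R.
  rewrite -natrD addnn.
  rewrite ler_pdivrMr ?exprn_gt0// -natrX -natrM ler_nat; exact: ltn_ord.
rewrite -natr1 => ? ?; apply/andP; split; lra.
Qed.

Lemma measurable_cells m k (P : pred (gidx m k)) : measurable (cells P).
Proof.
by apply: fin_bigcup_measurable => [|c _];
  [exact: finite_finset|exact: measurable_cell].
Qed.

Lemma cells_gbox m k (P : pred (gidx m k)) : cells P `<=` gbox m.
Proof. by move=> x [c _]; exact: cell_gbox. Qed.

Lemma cellsC m k (P : pred (gidx m k)) x :
  gbox m x -> ~ cells P x -> cells (predC P) x.
Proof.
move=> /(@gbox_cell m k)[c cx] Px; exists c => //=.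
by apply/negP => Pc; apply: Px; exists c.
Qed.

Lemma cells_predC m k (P : pred (gidx m k)) x : cells (predC P) x -> ~ cells P x.
Proof.
move=> [c /= Pc cx] [c' /= Pc' c'x]; move/negP: Pc; apply.
by rewrite (@trivIset_cell m k c c')//; exists x.
Qed.

End dyadic_grid.

(** * Approximation of Borel sets by unions of dyadic cells *)

Section grid_density.
Context (R : realType) (n m : nat).
Local Notation Rn := 'rV[R]_n.+1.
Local Notation Leb := (@lebesgue_rV R n.+1).
Local Notation gbox := (@gbox R n m).

Lemma lebesgue_gbox_lty (A : set Rn) : measurable A -> A `<=` gbox ->
  (Leb A < +oo)%E.
Proof.
move=> mA Ab; rewrite (@le_lt_trans _ _ (Leb gbox))//.
  by rewrite le_measure ?inE//; exact: measurable_gbox.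
by rewrite lebesgue_gbox ltry.
Qed.

Lemma lebesgue_cellsI k (P : pred (gidx n m k)) (X : set Rn) : measurable X ->
  Leb (cells P `&` X) = (\sum_(c | P c) Leb (cell c `&` X))%E.
Proof.
move=> mX; rewrite /cells setI_bigcupl measure_finType_bigcup//.
  by move=> c; apply: measurableI => //; exact: measurable_cell.
by apply: trivIset_setIr; exact: trivIset_cell.
Qed.

Lemma sum_cell_mass k (P : pred (gidx n m k)) (B : set Rn) :
  measurable B -> B `<=` gbox ->
  (\sum_(c | P c) fine (Leb (B `&` cell c)))%:E = Leb (cells P `&` B).
Proof.
move=> mB Bb; rewrite lebesgue_cellsI// -sumEFin; apply: eq_bigr => c _.
rewrite setIC fineK// ge0_fin_numE// lebesgue_gbox_lty//.
  by apply: measurableI => //; exact: measurable_cell.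
by move=> x [_ /Bb].
Qed.

(** The approximation is demanded at every level from some K on, so that two sets can be
    approximated on a common grid. Only the first difference is cut down to [gbox], since unions of
    cells already lie in it. *)
Definition grid_approx (A : set Rn) : Prop := measurable A /\
  forall e : R, 0 < e -> exists K, forall k, (K <= k)%N ->
  exists P : pred (gidx n m k),
    (Leb ((gbox `&` A) `\` cells P) < e%:E /\ Leb (cells P `\` A) < e%:E)%E.

(** The remaining cells approximate the complement: inside [gbox] the two errors trade places. *)
Lemma grid_approxC A : grid_approx A -> grid_approx (~` A).
Proof.
move=> [mA apA]; split=> [|e e0]; first exact: measurableC.
have [K HK] := apA _ e0; exists K => k /HK[P [P1 P2]]; exists (predC P).
have mP := @measurable_cells R n m k P.
have mC := @measurable_cells R n m k (predC P).
have mg := @measurable_gbox R n m.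
split.
- apply: le_lt_trans P2; apply: le_measure; rewrite ?inE.
  + by apply: measurableD => //; apply: measurableI => //; exact: measurableC.
  + exact: measurableD.
  + move=> x [[bx Ax] Cx]; split=> //.
    by apply: contrapT => Px; apply: Cx; exact: cellsC.
- apply: le_lt_trans P1; apply: le_measure; rewrite ?inE.
  + by apply: measurableD => //; exact: measurableC.
  + by apply: measurableD => //; exact: measurableI.
  + move=> x [Cx Ax]; split; last exact: cells_predC Cx.
    by split; [exact: cells_gbox Cx|exact: contrapT].
Qed.

Lemma grid_approxU A B : grid_approx A -> grid_approx B -> grid_approx (A `|` B).
Proof.
move=> [mA apA] [mB apB]; split=> [|e e0]; first exact: measurableU.
have e20 : 0 < e / 2 by rewrite divr_gt0.
have [K HK] := apA _ e20; have [L HL] := apB _ e20.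
exists (maxn K L) => k; rewrite geq_max => /andP[/HK[P [P1 P2]] /HL[Q [Q1 Q2]]].
exists (predU P Q).
have cPQ : cells (predU P Q) = cells P `|` cells Q :> set Rn.
  rewrite -bigcup_setU; congr (\bigcup_(c in _) _).
  by apply/seteqP; split=> c /orP.
rewrite cPQ.
have mP := @measurable_cells R n m k P.
have mQ := @measurable_cells R n m k Q.
have mg := @measurable_gbox R n m.
have e2 : (e%:E = (e / 2)%:E + (e / 2)%:E)%E by rewrite -EFinD -splitr.
have mcP X Y : measurable X -> measurable Y -> measurable ((gbox `&` X) `\` Y).
  by move=> ? ?; apply: measurableD => //; exact: measurableI.
rewrite e2; split.
- apply: (le_lt_trans _ (lteD P1 Q1)).
  apply: (@le_trans _ _ (Leb (((gbox `&` A) `\` cells P) `|`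
                              ((gbox `&` B) `\` cells Q)))).
    apply: le_measure; rewrite ?inE.
    + by apply: mcP; exact: measurableU.
    + by apply: measurableU; exact: mcP.
    + by move=> x [[bx [Ax|Bx]] /not_orP[Px Qx]]; [left|right].
  by apply: measureU2; exact: mcP.
- apply: (le_lt_trans _ (lteD P2 Q2)).
  apply: (@le_trans _ _ (Leb ((cells P `\` A) `|` (cells Q `\` B)))).
    apply: le_measure; rewrite ?inE.
    + by apply: measurableD; exact: measurableU.
    + by apply: measurableU; exact: measurableD.
    + by move=> x [[Px|Qx] /not_orP[Ax Bx]]; [left|right].
  by apply: measureU2; exact: measurableD.
Qed.

(* Monotone limits suffice, as finite unions are handled by [grid_approxU]. *)
Lemma grid_approx_nondecreasing (F : (set Rn)^nat) :
  (forall i, grid_approx (F i)) -> nondecreasing_seq F ->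
  grid_approx (\bigcup_i F i).
Proof.
move=> apF ndF.
have mF i : measurable (F i) by have [] := apF i.
have mU : measurable (\bigcup_i F i) by exact: bigcupT_measurable.
have mg := @measurable_gbox R n m.
split=> // e e0; have e20 : 0 < e / 2 by rewrite divr_gt0.
have [||||i Fi] := @nondecreasing_setD_lt R _ _ Leb (fun i => gbox `&` F i) (e / 2).
- by move=> i; exact: measurableI.
- move=> i j ij; apply/subsetPset; apply: setIS; apply/subsetPset; exact: ndF.
- rewrite -setI_bigcupr; apply: lebesgue_gbox_lty; first exact: measurableI.
  exact: subIsetl.
- by [].
have [_ apFi] := apF i; have [K HK] := apFi _ e20.
exists K => k /HK[P [P1 P2]]; exists P.
have mP := @measurable_cells R n m k P.
split.
- have -> : (e%:E = (e / 2)%:E + (e / 2)%:E)%E by rewrite -EFinD -splitr.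
  apply: (le_lt_trans _ (lteD Fi P1)); rewrite -setI_bigcupr.
  have m1 : measurable ((gbox `&` \bigcup_i F i) `\` (gbox `&` F i)).
    by apply: measurableD; exact: measurableI.
  have m2 : measurable ((gbox `&` F i) `\` cells P).
    by apply: measurableD => //; exact: measurableI.
  apply: le_trans (measureU2 _ m1 m2).
  apply: le_measure; rewrite ?inE.
  + by apply: measurableD => //; exact: measurableI.
  + exact: measurableU.
  + move=> x [[bx Ux] Px]; have [Fx|Fx] := pselect (F i x); first by right.
    by left; split=> // -[].
- apply: (@lt_trans _ _ (e / 2)%:E); last by rewrite lte_fin gtr_pMr// invf_lt1 ?ltr1n.
  apply: le_lt_trans P2; apply: le_measure; rewrite ?inE.
  + exact: measurableD.
  + exact: measurableD.
  + by apply: setDS => x Fx; exists i.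
Qed.

(** U is exhausted by the sets [far l] of points at sup-distance at least 2^-l from its complement.
    A cell of level k >= l that meets [far l] lies in U, so the cells contained in U miss at most
    what [far l] misses, and they have no excess. *)
Lemma grid_approx_open (U : set Rn) : open U -> grid_approx U.
Proof.
move=> oU; have mU := open_measurable_rV oU.
have mg := @measurable_gbox R n m.
pose far l : set Rn := [set x | forall y, ~ U y -> exists i,
  mesh R l <= `|x ord0 i - y ord0 i|].
have mfar l : measurable (far l).
  rewrite -[far l]setCK; apply: measurableC; apply: open_measurable_rV.
  rewrite (_ : ~` far l = \bigcup_(y in ~` U) ball y (mesh R l)).
    by apply: bigcup_open => y _; exact: ball_open.
  apply/seteqP; split=> [x /existsNP[y /not_implyP[Uy /forallNP yx]]|].
    exists y => //; split; first exact: mesh_gt0.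
    move=> i j; rewrite (ord1 i) /ball/= distrC ltNge; exact/negP.
  move=> x [y Uy [_ yx]] /(_ y Uy)[i]; rewrite leNgt distrC => /negP; apply.
  exact: yx.
have ndfar : nondecreasing_seq far.
  move=> k l kl; apply/subsetPset => x fx y /fx[i xy]; exists i.
  by rewrite (le_trans _ xy)// mesh_le.
have farU : \bigcup_l far l = U.
  apply/seteqP; split=> [x [l _ fx]|x Ux].
    apply: contrapT => /fx[i]; rewrite subrr normr0 leNgt mesh_gt0//.
  have /nbhs_ballP[e /= e0 xeU] : nbhs x U by exact: open_nbhs_nbhs.
  have [l le] := @mesh_lt R _ e0; exists l => // y Uy.
  apply: contrapT => /forallNP xy; apply/Uy/xeU; split=> // i j.
  rewrite (ord1 i) /ball/= (lt_trans _ le)// ltNge; exact/negP.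
split=> // e e0.
have [||||l Fl] := @nondecreasing_setD_lt R _ _ Leb (fun i => gbox `&` far i) e.
- by move=> i; exact: measurableI.
- move=> i j ij; apply/subsetPset; apply: setIS; apply/subsetPset; exact: ndfar.
- rewrite -setI_bigcupr; apply: lebesgue_gbox_lty.
    by rewrite farU; exact: measurableI.
  exact: subIsetl.
- by [].
exists l => k lk; exists (fun c => `[< cell c `<=` U >]).
have mP := @measurable_cells R n m k (fun c => `[< cell c `<=` U >]).
split.
  apply: le_lt_trans Fl; rewrite -setI_bigcupr farU.
  apply: le_measure; rewrite ?inE.
  + by apply: measurableD => //; exact: measurableI.
  + by apply: measurableD; exact: measurableI.
  move=> x [[bx Ux] Px]; split=> // -[_ fx]; apply: Px.
  have [c cx] := @gbox_cell R n m k x bx.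
  exists c => //=; apply/asboolP => y cy; apply: contrapT => /fx[i].
  apply/negP; rewrite -ltNge; apply: lt_le_trans (mesh_le _ lk).
  have := cx i; have := cy i.
  rewrite ltr_norml => /andP[? ?] /andP[? ?]; apply/andP; split; lra.
rewrite (_ : _ `\` _ = set0) ?measure0//.
by apply/seteqP; split=> // x [[c /= /asboolP cU /cU]].
Qed.

(** The approximable sets form a sigma-algebra containing the open sets. A countable union is the
    increasing union of its finite partial unions. *)
Lemma measurable_grid_approx (A : set Rn) : measurable A -> grid_approx A.
Proof.
have ap0 : grid_approx set0 by apply: grid_approx_open; exact: open0.
move: A; apply: smallest_sub; last exact: grid_approx_open.
split=> // [A|F apF]; first by rewrite setTD; exact: grid_approxC.
rewrite -bigcup_bigsetU_bigcup.
apply: grid_approx_nondecreasing => [i|].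
  elim: i => [|i IH]; first by rewrite big_ord1.
  by rewrite big_ord_recr/=; exact: grid_approxU.
by move=> i j ij; apply/subsetPset; exact: subset_bigsetU.
Qed.

(** Let P be cells approximating B up to e/2 on both sides. For a cell Q of P put a = |B /\ Q| and b
    = |Q \ B|, so that a + b = h^N. Then a^2 >= (a + b)(a - b) = h^N (a - b), while over P the sum
    of the a is at least |B| - e/2 and that of the b at most e/2. *)
Lemma grid_density (B : set Rn) (e : R) : measurable B -> B `<=` gbox -> 0 < e ->
  exists k, mesh R k ^+ n.+1 * (fine (Leb B) - e) <=
    \sum_(c : gidx n m k) fine (Leb (B `&` cell c)) ^+ 2.
Proof.
move=> mB Bb e0; have e20 : 0 < e / 2 by rewrite divr_gt0.
have [_ apB] := measurable_grid_approx mB.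
have [k HK] := apB _ e20; have [P [P1 P2]] := HK k (leqnn k); exists k.
have mP := @measurable_cells R n m k P.
have mc (c : gidx n m k) : measurable (cell c : set Rn) by exact: measurable_cell.
have finL (A : set Rn) : measurable A -> A `<=` gbox -> Leb A \is a fin_num.
  by move=> mA Ab; rewrite ge0_fin_numE// lebesgue_gbox_lty.
have mBc (c : gidx n m k) : measurable (B `&` cell c) by exact: measurableI.
have mcB (c : gidx n m k) : measurable (cell c `\` B) by exact: measurableD.
have cb (c : gidx n m k) : cell c `<=` gbox by exact: cell_gbox.
have finB := finL _ mB Bb.
pose v : R := mesh R k ^+ n.+1; rewrite -/v.
have v0 : 0 < v by rewrite exprn_gt0// mesh_gt0.
have split_cell (c : gidx n m k) :
    v = fine (Leb (B `&` cell c)) + fine (Leb (cell c `\` B)).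
  rewrite -fineD; last 2 first.
  - by apply: finL (mBc c) _ => x [] /Bb.
  - by apply: finL (mcB c) _ => x [] /cb.
  rewrite -[v]/(fine v%:E) -(lebesgue_cell R c) (measureDI _ (mc c) mB).
  by rewrite addeC setIC.
have leB : fine (Leb B) - e / 2 <= \sum_(c | P c) fine (Leb (B `&` cell c)).
  rewrite -lee_fin EFinB -sumEFin fineK//.
  under eq_bigr => c _.
    rewrite fineK; last by apply: finL (mBc c) _ => x [] /Bb.
    rewrite setIC; over.
  rewrite -lebesgue_cellsI// lee_subel_addr//; last first.
    by apply: finL => [|x [] /cells_gbox]//; exact: measurableI.
  rewrite (measureDI Leb mB mP) setIC addeC leeD2l// (le_trans _ (ltW P1))//.
  by rewrite setIidr.
have leC : \sum_(c | P c) fine (Leb (cell c `\` B)) <= e / 2.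
  rewrite -lee_fin -sumEFin.
  under eq_bigr => c _.
    rewrite fineK; last by apply: finL (mcB c) _ => x [] /cb.
    rewrite setDE; over.
  by rewrite -lebesgue_cellsI ?ltW//; exact: measurableC.
rewrite [leRHS](bigID P)/= ler_wpDr//.
  by rewrite sumr_ge0// => c _; exact: sqr_ge0.
have -> : v * (fine (Leb B) - e) = v * (fine (Leb B) - e / 2 - e / 2).
  by congr (_ * _); lra.
apply: le_trans (_ : \sum_(c | P c)
    v * (fine (Leb (B `&` cell c)) - fine (Leb (cell c `\` B))) <= _).
  by rewrite -mulr_sumr ler_wpM2l ?(ltW v0)// sumrB lerB.
apply: ler_sum => c _; rewrite (split_cell c).
move: (fine _) (fine _) => a b; have := sqr_ge0 b; nra.
Qed.

End grid_density.

(** * The potential of a set *)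

Section riesz_potential.
Context (R : realType).

(** Either q >= rho and the first term suffices, or q lies in a dyadic shell with rho 2^-(l+1) <= q
    < rho 2^-l, whose term suffices. The lower bound on q makes finitely many shells enough. *)
Lemma powRN_dyadic_le (rho q s : R) L : 0 < rho -> 0 < q -> 0 <= s ->
  rho * 2^-1 ^+ L <= q ->
  q `^ (- s) <= rho `^ (- s) +
    \sum_(l < L) (rho * 2^-1 ^+ l.+1) `^ (- s) * (q < rho * 2^-1 ^+ l)%R%:R.
Proof.
move=> rho0 q0 s0; have le_powRN a b : 0 < a -> a <= b -> b `^ (- s) <= a `^ (- s).
  move=> a0 ab; have b0 := lt_le_trans a0 ab.
  by rewrite !powRN lef_pV2 ?posrE ?powR_gt0// ge0_ler_powR ?nnegrE ?(ltW a0) ?(ltW b0).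
elim: L => [|L IH]; first by rewrite big_ord0 addr0 expr0 mulr1; exact: le_powRN.
move=> qL; have [/IH le1|lt1] := leP (rho * 2^-1 ^+ L) q.
  rewrite (le_trans le1)// lerD2l big_ord_recr/= lerDl.
  by rewrite mulr_ge0 ?powR_ge0.
rewrite big_ord_recr/= lt1 mulr1 addrA ler_wpDl//.
  by rewrite addr_ge0 ?powR_ge0// sumr_ge0// => l _; rewrite mulr_ge0 ?powR_ge0.
by apply: le_powRN => //; rewrite mulr_gt0// exprn_gt0.
Qed.

Lemma sum_geometric_le (t : R) L : 0 <= t < 1 -> \sum_(l < L) t ^+ l <= (1 - t)^-1.
Proof.
move=> /andP[t0 t1]; rewrite -[leRHS]mul1r ler_pdivlMr ?subr_gt0//.
have -> : (\sum_(l < L) t ^+ l) * (1 - t) = 1 - t ^+ L.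
  by rewrite -[RHS]opprB subrX1 -[1 - t]opprB mulrN mulrC.
by rewrite lerBlDr lerDl exprn_ge0.
Qed.

Context (n m k : nat).
Local Notation Rn := 'rV[R]_n.+1.
Local Notation Leb := (@lebesgue_rV R n.+1).
Local Notation gbox := (@gbox R n m).
Local Notation h := (mesh R k).

(** In each coordinate a corner counted here is within t of x, and its cell has side h <= q < t. The
    cells therefore lie in the box of half-side 2t about x. *)
Lemma sum_ball_mass_le (B : set Rn) (x : Rn) (t : R) :
  measurable B -> B `<=` gbox -> 0 < t ->
  \sum_(c : gidx n m k | qnorm h (x - corner R c) < t)
     fine (Leb (B `&` cell c)) <= (4 * t) ^+ n.+1.
Proof.
move=> mB Bb t0.
pose A (i : 'I_n.+1) : set (measurableTypeR R) :=
  [set` `[x ord0 i - 2 * t, x ord0 i + 2 * t[].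
have mA i : measurable (A i) by exact: measurable_itv.
rewrite -lee_fin sum_cell_mass//.
have -> : ((4 * t) ^+ n.+1)%:E = Leb [set y | forall i, A i (y ord0 i)].
  rewrite lebesgue_rV_box//.
  under eq_bigr => i _.
    rewrite (_ : lebesgue_measure _ = (4 * t)%:E); first over.
    rewrite lebesgue_measure_itv/= lte_fin ifT; last lra.
    by rewrite -EFinB; congr EFin; lra.
  by rewrite prodEFin prodr_const card_ord.
apply: le_measure; rewrite ?inE.
- by apply: measurableI => //; exact: measurable_cells.
- exact: measurable_coord_box.
move=> y [[c /= qc cy] _] i; rewrite /A /= in_itv/=.
have := ler_coord_qnorm h (x - corner R c) i; have /andP[] := cy i.
have := qnorm_ge_h (x - corner R c) (ltW (mesh_gt0 R k)).
rewrite !mxE ler_norml => ? ? ? /andP[? ?]; apply/andP; split; lra.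
Qed.

(** A discrete form of the estimate of the integral of |x - y|^-s over B. Beyond radius rho the
    total mass is used; within it, shell l has mass at most (4 rho 2^-l)^N, and the shells sum to a
    geometric series. The radius stays free, to be adapted to |B|. *)
Lemma riesz_sum_le (B : set Rn) (x : Rn) (s rho : R) :
  measurable B -> B `<=` gbox -> 0 <= s < n.+1%:R -> 0 < rho ->
  \sum_(c : gidx n m k)
     fine (Leb (B `&` cell c)) * qnorm h (x - corner R c) `^ (- s) <=
  rho `^ (- s) * fine (Leb B) +
  2 `^ s * 4 ^+ n.+1 / (1 - 2^-1 `^ (n.+1%:R - s)) * rho `^ (n.+1%:R - s).
Proof.
move=> mB Bb /andP[s0 sn] rho0; have h0 := mesh_gt0 R k.
(* Enough shells to reach down to scale h, below which [qnorm h] never falls. *)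
have [L hL] := @mesh_lt R (h / rho) (divr_gt0 h0 rho0).
have {}hL : rho * 2^-1 ^+ L <= h.
  by rewrite exprVn -ler_pdivlMl// mulrC ltW.
pose w (c : gidx n m k) := fine (Leb (B `&` cell c)); rewrite -/(w _).
pose q (c : gidx n m k) := qnorm h (x - corner R c : Rn).
have w0 c : 0 <= w c by rewrite fine_ge0.
have q0 c : 0 < q c by exact: qnorm_gt0.
have sumw : \sum_c w c = fine (Leb B).
  apply: EFin_inj; rewrite sum_cell_mass// setIidr ?fineK//.
    by rewrite ge0_fin_numE// (lebesgue_gbox_lty mB Bb).
  by move=> y /Bb /(@gbox_cell _ _ _ k)[c cy]; exists c.
apply: (@le_trans _ _ (\sum_c (w c * rho `^ (- s) + \sum_(l < L)
    (rho * 2^-1 ^+ l.+1) `^ (- s) * (w c * (q c < rho * 2^-1 ^+ l)%R%:R)))).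
  apply: ler_sum => c _.
  apply: le_trans (ler_wpM2l (w0 c) (@powRN_dyadic_le rho (q c) s L rho0 (q0 c) s0 _)) _.
    by rewrite (le_trans hL)// qnorm_ge_h// ltW.
  rewrite mulrDr mulr_sumr lerD2l ler_sum// => l _.
  by rewrite mulrCA.
rewrite big_split/= -mulr_suml sumw mulrC lerD2l exchange_big/=.
(* The ratio of the geometric series, less than 1 because s < N. *)
pose th : R := 2^-1 `^ (n.+1%:R - s).
have sn0 : 0 < n.+1%:R - s by rewrite subr_gt0.
have th01 : 0 <= th < 1.
  rewrite powR_ge0/=; have := @gt0_ltr_powR R _ sn0 2^-1 1.
  by rewrite !nnegrE powR1; apply => //; rewrite invf_lt1// ltr1n.
apply: (@le_trans _ _ (\sum_(l < L)
    2 `^ s * 4 ^+ n.+1 * rho `^ (n.+1%:R - s) * th ^+ l)).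
  apply: ler_sum => l _; rewrite -mulr_sumr.
  pose u := rho * 2^-1 ^+ l.
  have u0 : 0 < u by rewrite mulr_gt0.
  under eq_bigr => c _ do rewrite mulr_natr mulrb.
  rewrite -big_mkcond/=.
  apply: le_trans (ler_wpM2l (powR_ge0 _ _) (@sum_ball_mass_le B x u mB Bb u0)) _.
  rewrite exprSr mulrA -/u powRM ?(ltW u0)//.
  have -> : 2^-1 `^ (- s) = 2 `^ s :> R.
    by rewrite -powR_inv1// -powRrM mulN1r opprK.
  rewrite exprMn -(powR_mulrn _ (ltW u0)).
  rewrite [leLHS](_ : _ = 2 `^ s * 4 ^+ n.+1 * (u `^ n.+1%:R * u `^ (- s))); last by ring.
  rewrite -powRD ?(gt_eqF u0) ?implybT//.
  have -> : u `^ (n.+1%:R - s) = rho `^ (n.+1%:R - s) * th ^+ l.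
    rewrite /u powRM ?(ltW rho0) ?exprn_ge0//; congr (_ * _).
    by rewrite -!powR_mulrn ?powR_ge0// -!powRrM mulrC.
  by rewrite mulrA.
rewrite -mulr_sumr [leRHS]mulrAC ler_wpM2l ?mulr_ge0 ?powR_ge0 ?exprn_ge0//.
exact: sum_geometric_le.
Qed.

End riesz_potential.

(** * The potential of the point masses: Hölder bound and divergence *)

Section grid_potential.
Context (R : realType) (n m k : nat).
Local Notation Rn := 'rV[R]_n.+1.
Local Notation Leb := (@lebesgue_rV R n.+1).
Local Notation gbox := (@gbox R n m).
Local Notation h := (mesh R k).
Implicit Types (x y : Rn) (i : 'I_n.+1).
Variables (B : set Rn) (mB : measurable B) (Bb : B `<=` gbox).

Let w (c : gidx n m k) : R := fine (Leb (B `&` cell c)).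

Let h0 : 0 < h := mesh_gt0 R k.

Let w0 c : 0 <= w c.
Proof. by rewrite fine_ge0. Qed.

Definition potential i x := \sum_(c : gidx n m k) w c * newton h i (x - corner R c).

Definition dpotential i x := \sum_(c : gidx n m k) w c * dnewton h i (x - corner R c).

Let potentialE i : potential i =
  \sum_(c : gidx n m k) (w c \*: (fun x => newton h i (x - corner R c))).
Proof. by apply/funext => x; rewrite fct_sumE. Qed.

Lemma differentiable_potential i x : differentiable (potential i) x.
Proof.
rewrite potentialE; elim/big_ind : _ => //.
- by move=> f g; exact: differentiableD.
- by move=> c _; apply: differentiableZ; exact: differentiable_newton.
Qed.

Lemma derive_potential i x :
  'D_(unit_vec R i) (potential i) x = dpotential i x.
Proof.
rewrite potentialE; apply: (@derive_val _ _ _ _ _ _ _ _).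
rewrite /dpotential; elim/big_ind2 : _ => //.
- exact: is_derive_cst.
- by move=> f df g dg; exact: is_deriveD.
- by move=> c _; apply: is_deriveZ; exact: is_derive_newton.
Qed.

Lemma continuous_dpotential i : continuous (dpotential i).
Proof.
have -> : dpotential i =
    \sum_(c : gidx n m k) (fun x => w c * dnewton h i (x - corner R c)).
  by apply/funext => x; rewrite fct_sumE.
elim/big_ind : _ => [x|f g cf cg x|c _ x].
- exact: cst_continuous.
- exact: (continuousD (cf x) (cg x)).
- have c1 : {for x, continuous (fun _ : Rn => w c)} by exact: cst_continuous.
  exact: (continuousM c1 (@continuous_dnewton R n h i (corner R c) h0 x)).
Qed.

Let sumw : \sum_c w c = fine (Leb B).
Proof.
apply: EFin_inj; rewrite sum_cell_mass// setIidr ?fineK//.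
  by rewrite ge0_fin_numE// (lebesgue_gbox_lty mB Bb).
by move=> y /Bb /(@gbox_cell _ _ _ k)[c cy]; exists c.
Qed.

(** [newton_holder] is summed against the masses; its two negative powers, at x and at y, each
    contribute S. Leaving S arbitrary lets the same estimate serve with the sharp bound
    [riesz_sum_le] and, for al = 1, with a crude one. *)
Lemma potential_holder i x y (al S : R) : 0 <= al <= 1 ->
  (forall z, \sum_(c : gidx n m k)
     w c * qnorm h (z - corner R c) `^ (- (n%:R + al)) <= S) ->
  `|potential i x - potential i y| <=
  (n.+1%:R ^+ 2 + 1) * (2 * S) * enorm (x - y) `^ al.
Proof.
move=> al01 qS; rewrite -sumrB (le_trans (ler_norm_sum _ _ _))//.
pose M : R := n.+1%:R ^+ 2 + 1; have M0 : 0 <= M by rewrite addr_ge0 ?sqr_ge0.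
pose e (c : gidx n m k) z := qnorm h (z - corner R c : Rn) `^ (- (n%:R + al)).
apply: (@le_trans _ _ (\sum_(c : gidx n m k)
    M * enorm (x - y) `^ al * (w c * e c x + w c * e c y))).
  apply: ler_sum => c _; rewrite -mulrBr normrM (ger0_norm (w0 c)).
  rewrite -mulrDr mulrCA ler_wpM2l//.
  have := newton_holder (x - corner R c) (y - corner R c) i h0 al01.
  by rewrite opprB addrA subrK.
rewrite -mulr_sumr mulrAC ler_wpM2r ?powR_ge0// ler_wpM2l// big_split/=.
by rewrite [2 * S]mulr_natl mulr2n; apply: lerD; exact: qS.
Qed.

(** The crude bound [qnorm h >= h] is enough, since a test function is only asked to have a finite
    Lipschitz constant. *)
Lemma is_lip_potential i : is_lip (potential i).
Proof.
pose S := h `^ (- (n%:R + 1)) * fine (Leb B).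
have qS z : \sum_(c : gidx n m k)
    w c * qnorm h (z - corner R c) `^ (- (n%:R + 1)) <= S.
  rewrite /S -sumw mulr_sumr ler_sum// => c _; rewrite mulrC ler_wpM2r//.
  rewrite !powRN lef_pV2 ?posrE ?powR_gt0 ?qnorm_gt0//.
  by rewrite ge0_ler_powR ?nnegrE ?addr_ge0 ?(ltW h0) ?qnorm_ge_h// ltW// qnorm_gt0.
have al01 : 0 <= (1 : R) <= 1 by rewrite ler01 lexx.
have := lip_le (fun x y => potential_holder i x y al01 qS).
by move=> /le_lt_trans; apply; exact: ltry.
Qed.

Lemma sum_dpotential x : \sum_i dpotential i x =
  \sum_(c : gidx n m k) w c * (n.+1%:R * h ^+ 2 / qnorm h (x - corner R c) ^+ n.+3).
Proof.
by rewrite exchange_big/=; apply: eq_bigr => c _; rewrite -mulr_sumr sum_dnewton.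
Qed.

(** All terms of the divergence are nonnegative, so the term of the cell containing x may be kept
    alone. On that cell q^2 <= h^2 + N h^2 <= (N+1)^2 h^2, whence the power of [n.+2]. *)
Lemma sum_dpotential_cell x c : cell c x ->
  n.+1%:R / n.+2%:R ^+ n.+3 / h ^+ n.+1 * w c <= \sum_i dpotential i x.
Proof.
move=> cx; rewrite sum_dpotential (bigD1 c)//= ler_wpDr//.
  apply: sumr_ge0 => c' _; rewrite !mulr_ge0// ?invr_ge0 ?exprn_ge0 ?(ltW h0)//.
  by rewrite ltW// qnorm_gt0.
rewrite mulrC ler_wpM2l//.
have q0 := qnorm_gt0 (x - corner R c) h0.
have qh : qnorm h (x - corner R c) <= n.+2%:R * h.
  rewrite -(ler_pXn2r (n:=2)) ?nnegrE ?mulr_ge0 ?(ltW h0) ?(ltW q0)//.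
  rewrite sqr_qnorm exprMn.
  have : \sum_i (x - corner R c) ord0 i ^+ 2 <= \sum_(i < n.+1) h ^+ 2.
    apply: ler_sum => i _; have /andP[c1 c2] := cx i.
    have -> : (x - corner R c) ord0 i = x ord0 i - corner R c ord0 i by rewrite !mxE.
    by rewrite lerXn2r ?nnegrE ?(ltW h0) ?(ltW c2).
  rewrite sumr_const card_ord -[_ *+ n.+1]mulr_natl =>
    /(lerD (lexx (h ^+ 2))) /le_trans; apply.
  have -> : h ^+ 2 + n.+1%:R * h ^+ 2 = n.+2%:R * h ^+ 2.
    by rewrite -[n.+2%:R]natr1; ring.
  rewrite ler_wpM2r ?sqr_ge0//.
  by rewrite expr2 ler_peMl// ler1n.
move: (qnorm _ _) q0 qh => q q0 qh.
have -> : n.+1%:R / n.+2%:R ^+ n.+3 / h ^+ n.+1 =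
    n.+1%:R * h ^+ 2 / (n.+2%:R * h) ^+ n.+3.
  rewrite -[n.+3]addn2 !exprD !exprMn !exprS; field.
  by rewrite !expf_neq0 ?gt_eqF//= mulr1 mulf_neq0// gt_eqF.
apply: ler_wpM2l; first by apply: mulr_ge0; rewrite ?sqr_ge0.
have Nh0 : 0 < n.+2%:R * h by rewrite mulr_gt0.
by rewrite lef_pV2 ?posrE ?exprn_gt0// lerXn2r ?nnegrE ?(ltW Nh0) ?(ltW q0).
Qed.

Let integrable_indic_lty (A : set Rn) : measurable A -> (Leb A < +oo)%E ->
  Leb.-integrable setT (fun x => (\1_A x)%:E).
Proof.
move=> mA Aoo; apply/integrableP; split.
  by apply/measurable_EFinP; exact: measurable_indic.
under eq_integral => x _ do rewrite gee0_abs ?lee_fin//.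
by rewrite integral_indic// setIT.
Qed.

Lemma integrable_dpotential i :
  Leb.-integrable setT (fun x => (\1_B x * dpotential i x)%:E).
Proof.
have mi : measurable_fun setT (dpotential i : Rn -> R).
  apply: (@continuous_measurable_rV R n); exact: continuous_dpotential.
pose M : R := (\sum_c w c) * (n.+2%:R / h ^+ n.+1).
apply: (@le_integrable _ _ _ Leb setT measurableT _ (fun x => (\1_B x * M)%:E)).
- apply/measurable_EFinP; apply: measurable_funM => //; exact: measurable_indic.
- move=> x _; rewrite !abse_EFin lee_fin normrM [leRHS]normrM ler_wpM2l//.
  apply: (@le_trans _ _ M); last exact: ler_norm.
  rewrite /dpotential (le_trans (ler_norm_sum _ _ _))// /M mulr_suml.
  apply: ler_sum => c _.
  by rewrite normrM (ger0_norm (w0 c)) ler_wpM2l// dnewton_le.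
- rewrite (_ : (fun x => _) = (fun x => M%:E * (\1_B x)%:E)%E); last first.
    by apply/funext => x; rewrite mulrC EFinM.
  apply: integrableZl => //; apply: integrable_indic_lty => //.
  exact: lebesgue_gbox_lty mB Bb.
Qed.

(** On B /\ Q the divergence is at least a multiple of the mass |B /\ Q|. Integration over B /\ Q
    produces the square of that mass. *)
Lemma integral_sum_dpotential_ge :
  ((n.+1%:R / n.+2%:R ^+ n.+3 / h ^+ n.+1 * \sum_c w c ^+ 2)%:E <=
   \sum_i \int[Leb]_x (\1_B x * dpotential i x)%:E)%E.
Proof.
rewrite -(integral_sum measurableT integrable_dpotential).
pose a : R := n.+1%:R / n.+2%:R ^+ n.+3 / h ^+ n.+1; rewrite -/a.
have a0 : 0 <= a by rewrite !mulr_ge0// invr_ge0 exprn_ge0// ltW.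
under eq_integral => x _.
  rewrite sumEFin -mulr_sumr.
  over.
have mBc (c : gidx n m k) : measurable (B `&` cell c : set Rn).
  by apply: measurableI => //; exact: measurable_cell.
have awB (c : gidx n m k) x : 0 <= a * w c * \1_(B `&` cell c) x.
  by apply: mulr_ge0; [exact: mulr_ge0|rewrite indicE].
have -> : (a * \sum_c w c ^+ 2)%:E =
    (\int[Leb]_x \sum_(c : gidx n m k) (a * w c * \1_(B `&` cell c) x)%:E)%E.
  rewrite ge0_integral_sum//.
  - rewrite mulr_sumr -sumEFin; apply: eq_bigr => c _.
    under eq_integral => x _ do rewrite EFinM.
    have Boo : (Leb (B `&` cell c) < +oo)%E.
      by apply: (@lebesgue_gbox_lty R n m) => // x [/Bb].
    rewrite integralZl//; last exact: integrable_indic_lty.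
    rewrite integral_indic// setIT expr2 mulrA EFinM; congr (_ * _)%E.
    by rewrite /w fineK// ge0_fin_numE.
  - move=> c; apply/measurable_EFinP.
    by apply: measurable_funM => //; exact: measurable_indic.
  - by move=> c x _; rewrite lee_fin.
apply: ge0_le_integral => //.
- by move=> x _; apply: sume_ge0 => c _; rewrite lee_fin.
- apply: emeasurable_sum => c; apply/measurable_EFinP.
  by apply: measurable_funM => //; exact: measurable_indic.
- apply/measurable_EFinP; apply: measurable_funM; first exact: measurable_indic.
  apply: measurable_sum => i.
  by apply: (@continuous_measurable_rV R n); exact: continuous_dpotential.
move=> x _; rewrite sumEFin lee_fin.
(* Off B both sides vanish. On B exactly one cell contains x, so the sum of indicators has a single
   nonzero term. *)
have [xB|xB] := boolP (x \in B); last first.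
  rewrite indicE (negbTE xB) mul0r sumr_le0// => c _.
  rewrite indicE; case: (boolP (x \in _)) => [/set_mem[Bx _]|_]; last by rewrite mulr0.
  by rewrite (mem_set Bx) in xB.
have [c cx] := @gbox_cell R n m k x (Bb (set_mem xB)).
rewrite (bigD1 c)//= big1 ?addr0 => [|c' c'c]; last first.
  rewrite indicE; case: (boolP (x \in _)) => [/set_mem[_ c'x]|_]; last by rewrite mulr0.
  by move/eqP : c'c; case; apply: (@trivIset_cell R n m k) => //; exists x.
rewrite !indicE xB mul1r (_ : x \in B `&` cell c) ?mulr1 ?sum_dpotential_cell//.
by apply/mem_set; split => //; exact: set_mem.
Qed.

End grid_potential.

(** * The isoperimetric inequality *)

Section isoperimetric.
Context (R : realType) (n m : nat).
Local Notation Rn := 'rV[R]_n.+1.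
Local Notation Leb := (@lebesgue_rV R n.+1).
Local Notation gbox := (@gbox R n m).

Lemma fvar_ge0 (al : R) (u : Rn -> R) : (0 <= fvar al u)%E.
Proof. by apply: le_ereal_inf_tmp => C []. Qed.

(** The potential is tested against the other coordinates; the sign of the determinant disappears in
    the absolute value. *)
Lemma integral_dpotential_le k (B : set Rn) (al v L : R) (i : 'I_n.+1) :
  measurable B -> B `<=` gbox -> fvar al (\1_B : Rn -> R) = v%:E -> 0 < L ->
  (forall x y, `|potential m k B i x - potential m k B i y| <= L * enorm (x - y) `^ al) ->
  (\int[Leb]_x (\1_B x * dpotential m k B i x)%:E <= (v * L)%:E)%E.
Proof.
move=> mB Bb fv L0 pL.
have := fvar_test (\1_B : Rn -> R) L0 (is_lip_potential k mB Bb i) pL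
  (lip_other_coords R i).
under eq_integral => x _.
  rewrite detD_other_coords; last exact: differentiable_potential.
  rewrite derive_potential mulrCA EFinM.
  over.
rewrite integralZl//; last exact: (integrable_dpotential k mB Bb i).
rewrite abseM abse_EFin normrX normrN1 expr1n mul1e fv -EFinM.
by apply: le_trans; exact: lee_abs.
Qed.

(** The radius rho = |B|^(1/N) makes both terms of [riesz_sum_le] multiples of rho^(N-s). The tests
    then bound a multiple of |B| = rho^N by a multiple of v rho^(N-s), and dividing by rho^(N-s)
    leaves rho^s. *)
Lemma isoperimetric_endpoint (al : R) : 0 <= al < 1 ->
  exists2 K : R, 0 < K & forall (B : set Rn) (b v : R),
    measurable B -> B `<=` gbox -> Leb B = b%:E -> 0 < b ->
    fvar al (\1_B : Rn -> R) = v%:E ->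
    (b `^ (n.+1%:R^-1)) `^ (n%:R + al) <= K * v.
Proof.
move=> /andP[al0 al1].
pose s : R := n%:R + al; pose p : R := n.+1%:R - s.
have s0 : 0 <= s by rewrite addr_ge0.
have sn : s < n.+1%:R by rewrite -natr1 ltrD2l.
pose C : R := 2 `^ s * 4 ^+ n.+1 / (1 - 2^-1 `^ p).
have C0 : 0 <= C.
  rewrite mulr_ge0 ?mulr_ge0 ?powR_ge0 ?exprn_ge0// invr_ge0 subr_ge0.
  rewrite -[leRHS](powRr0 (2^-1 : R)) ger_powR//.
    by rewrite invr_gt0 invf_le1 ?ler1n ?ltr0n.
  by rewrite subr_ge0 ltW.
pose M : R := n.+1%:R ^+ 2 + 1.
have M0 : 0 < M by rewrite ltr_wpDl ?sqr_ge0.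
pose c1 : R := n.+1%:R / n.+2%:R ^+ n.+3.
have c10 : 0 < c1 by rewrite divr_gt0// exprn_gt0.
(* The factors are the number N of tests, the Hölder constant of the potential without rho^p, and
   the lower bound c1 / 2 from the divergence. Neither [m] nor the level of the grid enters. *)
exists (n.+1%:R * (M * (2 * (1 + C))) / (c1 / 2)).
  apply: divr_gt0; last by rewrite divr_gt0.
  by rewrite !mulr_gt0// ltr_wpDr.
move=> B b v mB Bb LB b0 fv.
have fB : fine (Leb B) = b by rewrite LB.
set rho := b `^ (n.+1%:R^-1).
have rho0 : 0 < rho by rewrite powR_gt0.
have rhoN : b = rho `^ s * rho `^ p.
  rewrite -powRD ?(gt_eqF rho0) ?implybT// addrC subrK /rho -powRrM mulVf ?powRr1 ?ltW//.
pose L := M * (2 * ((1 + C) * rho `^ p)).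
have L0 : 0 < L by rewrite !mulr_gt0 ?powR_gt0// ltr_wpDr.
(* Half of |B| is conceded as the grid error. This fixes a level k depending on B, while the
   constants do not depend on k. *)
have b20 : 0 < b / 2 by rewrite divr_gt0.
have [k Hk] := grid_density mB Bb b20; rewrite fB in Hk.
have qS z : \sum_(c : gidx n m k) fine (Leb (B `&` cell c)) *
    qnorm (mesh R k) (z - corner R c) `^ (- s) <= (1 + C) * rho `^ p.
  have s01 : 0 <= s < n.+1%:R by rewrite s0.
  apply: le_trans (riesz_sum_le k z mB Bb s01 rho0) _.
  rewrite fB mulrDl mul1r lerD2r {1}rhoN mulrA -powRD ?(gt_eqF rho0) ?implybT//.
  by rewrite addNr powRr0 mul1r.
have al01 : 0 <= al <= 1 by rewrite al0 ltW.
have int_le i : (\int[Leb]_x (\1_B x * dpotential m k B i x)%:E <= (v * L)%:E)%E.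
  apply: (integral_dpotential_le mB Bb fv L0) => x y.
  exact: (potential_holder _ x y al01 qS).
have := integral_sum_dpotential_ge k mB Bb.
set W := \sum_c _ => WL.
have {}WL : c1 / mesh R k ^+ n.+1 * W <= n.+1%:R * (v * L).
  rewrite -lee_fin (le_trans WL)//.
  apply: le_trans (lee_sum _ (fun i _ => int_le i)) _.
  by rewrite sumEFin sumr_const card_ord mulr_natl.
have hN : 0 < mesh R k ^+ n.+1 by rewrite exprn_gt0// mesh_gt0.
have bL : c1 * (b / 2) <= n.+1%:R * (v * L).
  apply: le_trans WL; rewrite -mulrA ler_wpM2l ?(ltW c10)//.
  rewrite ler_pdivlMl//; apply: le_trans Hk; rewrite ler_wpM2l ?(ltW hN)//; lra.
rewrite [leRHS]mulrAC ler_pdivlMr ?divr_gt0//.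
rewrite -(ler_pM2r (powR_gt0 p rho0)).
apply: le_trans (_ : c1 * (b / 2) <= _).
  by rewrite [X in _ <= _ * (X / 2)]rhoN; lra.
apply: (le_trans bL); rewrite /L; lra.
Qed.

End isoperimetric.

(* The dimension of the ambient space is n.+1 >= 1. *)
Theorem corollary3p6 (R : realType) (n : nat) (d alpha r : R)
    (r_gt0 : 0 < r) (alpha_ge0 : 0 <= alpha) (alpha_lt1 : alpha < 1)
    (d_gt : n.+1%:R - 1 + alpha < d) (d_le : d <= n.+1%:R) :
  exists C : R, forall B : set 'rV[R]_n.+1,
    measurable B ->
    (forall x, B x -> forall i, - r <= x ord0 i <= r) ->
    BVc alpha (\1_B : 'rV[R]_n.+1 -> R) ->
    (lebesgue_rV B <=
       C%:E * fvar alpha (\1_B : 'rV[R]_n.+1 -> R) `^ (n.+1%:R / d))%E.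
Proof.
have al01 : 0 <= alpha < 1 by rewrite alpha_ge0.
(* An integer strictly above r, so that the half-open [gbox m] contains the closed cube. *)
pose m := (Num.truncn r).+1.
have rm : r < m%:R by exact: truncnS_gt.
have [K K0 HK] := @isoperimetric_endpoint R n m alpha al01.
pose s : R := n%:R + alpha.
have s0 : 0 <= s by rewrite addr_ge0.
have sd : s < d by move: d_gt; rewrite -natr1 addrK.
have d0 : 0 < d by exact: le_lt_trans sd.
(* Since B lies in a cube of side 2m, rho = |B|^(1/N) is at most 2m. Hence rho^d = rho^s rho^(d-s)
   <= K v (2m)^(d-s), which raised to the power N / d is the claim. *)
pose K' := K * m.*2%:R `^ (d - s).
exists (K' `^ (n.+1%:R / d)) => B mB Br [_ Voo].
have Bb : B `<=` gbox m.
  by move=> x /Br xr i; have /andP[? ?] := xr i; apply/andP; split; lra.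
have finB : lebesgue_rV B \is a fin_num.
  by rewrite ge0_fin_numE// (lebesgue_gbox_lty mB Bb).
have finV : fvar alpha (\1_B : 'rV[R]_n.+1 -> R) \is a fin_num.
  by rewrite ge0_fin_numE// fvar_ge0.
have V0 := fvar_ge0 alpha (\1_B : 'rV[R]_n.+1 -> R).
have B0 : (0 <= lebesgue_rV B)%E by [].
have Bm : (lebesgue_rV B <= (m.*2%:R ^+ n.+1)%:E)%E.
  by rewrite -(lebesgue_gbox R) le_measure ?inE//; exact: measurable_gbox.
have := HK B; move: finV finB V0 B0 Bm.
case: (fvar _ _) => // v _; case: (lebesgue_rV B) => // b _.
rewrite !lee_fin => v0 b0 bm /(_ b v mB Bb erefl).
have [->|bN0] := eqVneq b 0; first by rewrite mulr_ge0 ?powR_ge0.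
have {bN0}b0 : 0 < b by rewrite lt_neqAle eq_sym bN0.
move=> /(_ b0 erefl); rewrite -/s.
set rho := b `^ (n.+1%:R^-1) => rhos.
have rho0 : 0 < rho by rewrite powR_gt0.
have rhom : rho <= m.*2%:R.
  apply: (@le_trans _ _ ((m.*2%:R ^+ n.+1) `^ (n.+1%:R^-1))).
    by rewrite ge0_ler_powR// nnegrE ?exprn_ge0// ltW.
  by rewrite -powR_mulrn// -powRrM mulfV// powRr1.
have rhod : rho `^ d <= K' * v.
  rewrite -[d](subrK s) powRD ?(gt_eqF rho0) ?implybT// mulrC.
  rewrite /K' mulrAC ler_pM ?powR_ge0// ge0_ler_powR ?nnegrE ?(ltW rho0)//.
  by rewrite subr_ge0 ltW.
have -> : b = (rho `^ d) `^ (n.+1%:R / d).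
  rewrite /rho -!powRrM (_ : _ * _ = 1) ?powRr1 ?(ltW b0)//.
  by rewrite mulrCA mulKf ?pnatr_eq0// divff// gt_eqF.
rewrite -powRM//; last by rewrite mulr_ge0 ?powR_ge0// ltW.
rewrite ge0_ler_powR ?nnegrE ?powR_ge0// ?divr_ge0 ?(ltW d0)//.
by rewrite (le_trans _ rhod)// powR_ge0.
Qed.
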